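(* Consider the PPDS iteration described in the context and assume: (1) each $f_i$ is convex and $L$-smooth (differentiable with $L$-Lipschitz gradient), and $f$ is $\mu$-strongly convex with $\mu>0$; let $x^\star$ be the unique minimizer of $f$; (2) the triples $(V_t,A_t,B_t)_{t\ge 1}$ are independent and identically distributed over $t$ (no independence is required between $V_t$, $A_t$ and $B_t$ for the same $t$); (3) for all $t\ge 1$, $A_t$ is row-stochastic and $B_t$ is column-stochastic; $A:=\mathbb{E}[A_1]$ and $B:=\mathbb{E}[B_1]$ are primitive; and there is $\kappa>0$ such that $(A_t)_{ii}\ge\kappa$ and $(B_t)_{ii}\ge\kappa$ for all $i\in V$ and $t\ge1$; (4) $p_i:=\mathbb{P}(i\in V_1)>0$ for all $i\in V$. Then there exists $\eta_0>0$ such that, for every step-size $\eta\in(0,\eta_0]$ and every node $i\in V$: a) $x_{i,t}$ converges almost surely to $x^\star$ as $t\to\infty$; b) $\mathbb{E}[\|x_{i,t}-x^\star\|^2]$ vanishes geometrically, i.e. there exist $c\ge0$ and $\rho\in(0,1)$ such that $\mathbb{E}[\|x_{i,t}-x^\star\|^2]\le c\,\rho^t$ for all $t\ge1$.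
   Context: Setting. There are $n$ nodes, indexed by $V=\{1,\dots,n\}$, and functions $f_i:\mathbb{R}^d\to\mathbb{R}$, $i\in V$; put $f=\frac1n\sum_{i=1}^n f_i$. For a matrix $X\in\mathbb{R}^{n\times d}$ with rows $x_1,\dots,x_n$, $\nabla F(X)\in\mathbb{R}^{n\times d}$ denotes the matrix whose $i$-th row is $\nabla f_i(x_i)$. $(V_t)_{t\ge1}$ is a sequence of random subsets of $V$ (the active nodes), and $(A_t)_{t\ge1}$, $(B_t)_{t\ge1}$ are sequences of random $n\times n$ matrices with non-negative entries, compatible with a fixed directed communication graph $(V,E)$, meaning that their $(i,j)$ entry is $0$ whenever $(j,i)\notin E$. $D_t=\mathrm{diag}(\mathbf 1_{i\in V_t})$ is the diagonal matrix whose $i$-th diagonal element is $1$ if $i\in V_t$ and $0$ otherwise. PPDS iteration. Given a fixed (deterministic) initial $X_1\in\mathbb{R}^{n\times d}$ and a step-size $\eta>0$, set $C_1=X_1$, $Y_1=\nabla F(X_1)$, and for $t\ge1$ $$Y_{t+1/2}=Y_t+D_t(\nabla F(X_t)-\nabla F(C_t)),\quad X_{t+1/2}=X_t-\eta D_tY_{t+1/2},\quad C_{t+1}=D_tX_t+(I-D_t)C_t,$$ $$Y_{t+1}=B_tY_{t+1/2},\quad X_{t+1}=A_tX_{t+1/2}.$$ The $i$-th row of $X_t$ is denoted $x_{i,t}$. Conventions: a non-negative matrix $P$ is row-stochastic if $P\mathbf 1=\mathbf 1$ and column-stochastic if $\mathbf 1^\top P=\mathbf 1^\top$, where $\mathbf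 1$ is the all-ones vector; a square non-negative matrix $P$ is primitive if $P^k>0$ entrywise for some $k\ge1$. *)

(* Defs.v *)
From HB Require Import structures.
From mathcomp Require Import all_boot all_order all_algebra.
From mathcomp Require Import all_classical all_reals all_analysis.

Set Implicit Arguments.
Unset Strict Implicit.
Unset Printing Implicit Defensive.

Import Order.TTheory GRing.Theory Num.Theory.
Import numFieldNormedType.Exports.

Local Open Scope classical_set_scope.
Local Open Scope ring_scope.

(* The norm that the library puts on row vectors is the sup norm, hence an
   explicit Euclidean norm; the two induce the same topology. *)
Definition enorm (R : realType) (p : nat) (x : 'rV[R]_p) : R :=
  Num.sqrt (\sum_(j < p) x 0 j ^+ 2).

Definition gradient (R : realType) (p : nat) (g : 'rV[R]_p -> R)
    (x : 'rV[R]_p) : 'rV[R]_p :=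
  \row_(j < p) 'D_(delta_mx 0 j) g x.

Definition smooth (R : realType) (p : nat) (L : R) (g : 'rV[R]_p -> R) : Prop :=
  (forall x, differentiable g x) /\
  (forall x y, enorm (gradient g x - gradient g y) <= L * enorm (x - y)).

Definition strongly_convex (R : realType) (p : nat) (mu : R)
    (g : 'rV[R]_p -> R) : Prop :=
  forall (x y : 'rV[R]_p) (t : R), 0 <= t -> t <= 1 ->
    g (t *: x + (1 - t) *: y) <=
      t * g x + (1 - t) * g y - mu / 2 * (t * (1 - t)) * enorm (x - y) ^+ 2.

Definition minimizer (R : realType) (p : nat) (g : 'rV[R]_p -> R)
    (x : 'rV[R]_p) : Prop :=
  forall y, g x <= g y.

Definition nonneg_mx (R : realType) (n : nat) (M : 'M[R]_n) : Prop :=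
  forall i j, 0 <= M i j.

Definition row_stochastic (R : realType) (n : nat) (M : 'M[R]_n) : Prop :=
  nonneg_mx M /\ M *m (const_mx 1 : 'cV[R]_n) = const_mx 1.

Definition column_stochastic (R : realType) (n : nat) (M : 'M[R]_n) : Prop :=
  nonneg_mx M /\ (const_mx 1 : 'rV[R]_n) *m M = const_mx 1.

Definition primitive_mx (R : realType) (n : nat) (M : 'M[R]_n) : Prop :=
  nonneg_mx M /\
  exists2 k : nat, (1 <= k)%N & forall i j, 0 < (M ^+ k) i j.

(* The entry (i, j) carries what node j sends to node i, along the edge
   e j i from j to i. *)
Definition compatible (R : realType) (n : nat) (e : rel 'I_n)
    (M : 'M[R]_n) : Prop :=
  forall i j, ~~ e j i -> M i j = 0.

Definition average (R : realType) (n p : nat) (f : 'I_n -> 'rV[R]_p -> R)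
    (x : 'rV[R]_p) : R :=
  n%:R^-1 * \sum_(i < n) f i x.

Definition gradF (R : realType) (n p : nat) (f : 'I_n -> 'rV[R]_p -> R)
    (X : 'M[R]_(n, p)) : 'M[R]_(n, p) :=
  \matrix_(i < n) gradient (f i) (row i X).

Definition active_mx (R : realType) (n : nat) (V : {set 'I_n}) : 'M[R]_n :=
  diag_mx (\row_(i < n) (i \in V)%:R).

(* States are triples (X, Y, C). *)
Definition ppds_step (R : realType) (n p : nat) (f : 'I_n -> 'rV[R]_p -> R)
    (eta : R) (V : {set 'I_n}) (A B : 'M[R]_n)
    (s : 'M[R]_(n, p) * 'M[R]_(n, p) * 'M[R]_(n, p)) :
    'M[R]_(n, p) * 'M[R]_(n, p) * 'M[R]_(n, p) :=
  let: (X, Y, C) := s in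
  let D := active_mx R V in
  let Yhalf := Y + D *m (gradF f X - gradF f C) in
  let Xhalf := X - eta *: (D *m Yhalf) in
  (A *m Xhalf, B *m Yhalf, D *m X + (1%:M - D) *m C).

(* [ppds_state f eta X1 V A B k] is the state at time k.+1: time starts at 1,
   and the values of V, A and B at index 0 are never used. *)
Fixpoint ppds_state (R : realType) (n p : nat) (f : 'I_n -> 'rV[R]_p -> R)
    (eta : R) (X1 : 'M[R]_(n, p)) (V : nat -> {set 'I_n}) (A B : nat -> 'M[R]_n)
    (k : nat) : 'M[R]_(n, p) * 'M[R]_(n, p) * 'M[R]_(n, p) :=
  if k is k'.+1 then
    ppds_step f eta (V k) (A k) (B k) (ppds_state f eta X1 V A B k')
  else (X1, gradF f X1, X1).

Definition ppds_x (R : realType) (n p : nat) (f : 'I_n -> 'rV[R]_p -> R)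
    (eta : R) (X1 : 'M[R]_(n, p)) (V : nat -> {set 'I_n}) (A B : nat -> 'M[R]_n)
    (i : 'I_n) (t : nat) : 'rV[R]_p :=
  row i (ppds_state f eta X1 V A B t.-1).1.1.

Definition node_subset (n : nat) : Type := {set 'I_n}.

HB.instance Definition _ (n : nat) := Finite.on (node_subset n).
HB.instance Definition _ (n : nat) := isPointed.Build (node_subset n) (@finset.set0 _).
HB.instance Definition _ (n : nat) :=
  @isMeasurable.Build default_measure_display (node_subset n)
    discrete_measurable discrete_measurable0
    discrete_measurableC discrete_measurableU.

Notation borel_mx R n := (g_sigma_algebraType (@open 'M[R]_n)).

Definition draw (R : realType) (n : nat) (T : Type) (V : T -> {set 'I_n})
    (A B : T -> 'M[R]_n) (w : T) :
    (node_subset n * borel_mx R n * borel_mx R n)%type :=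
  (V w, A w, B w).

Definition mean_mx (dsp : measure_display) (T : measurableType dsp)
    (R : realType) (P : probability T R) (n : nat) (M : T -> 'M[R]_n) :
    'M[R]_n :=
  \matrix_(i < n, j < n) fine 'E_P[fun w => M w i j].

Definition independent_family (dsp dsp' : measure_display)
    (T : measurableType dsp) (S : measurableType dsp') (R : realType)
    (P : probability T R) (I : set nat) (Z : nat -> T -> S) : Prop :=
  forall (s : seq nat) (E : nat -> set S),
    uniq s -> [set` s] `<=` I -> (forall t, measurable (E t)) ->
    P (\bigcap_(t in [set` s]) (Z t @^-1` E t)) =
      (\prod_(t <- s) P (Z t @^-1` E t))%E.

Definition iid (dsp dsp' : measure_display)
    (T : measurableType dsp) (S : measurableType dsp') (R : realType)
    (P : probability T R) (I : set nat) (Z : nat -> T -> S) : Prop :=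
  [/\ forall t, I t -> measurable_fun setT (Z t),
      independent_family P I Z &
      forall s t E, I s -> I t -> measurable E ->
        P (Z s @^-1` E) = P (Z t @^-1` E)].

(* Main.v *)
Require Import Defs.
From HB Require Import structures.
From mathcomp Require Import all_boot all_order all_algebra.
From mathcomp Require Import all_classical all_reals all_analysis.
From mathcomp Require Import measurable_realfun ring lra.

Set Implicit Arguments.
Unset Strict Implicit.
Unset Printing Implicit Defensive.

Import Order.TTheory GRing.Theory Num.Theory.
Import numFieldNormedType.Exports.

Local Open Scope classical_set_scope.
Local Open Scope ring_scope.

(** Write u for the all-ones row.  Two invariants hold almost surely: the sum
    u Y of the trackers is the sum of the gradients at the stored points C, and
    the push-sum weights defined by pi := B pi, started from the uniform vector,
    stay a probability vector.  So Y = pi (u Y) + Z where Z has zero column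
    sums, and Z is the error of the tracking.

    Let phi be the stationary distribution of the mean matrix E[A], and set
    x := phi X.  Given the past, the mean of the next x is x - eta q (Y + U)
    with U := grad F(X) - grad F(C) and q := phi E[A D].  Every entry of q is at
    least some q0 > 0, because the diagonal of A is bounded below and every node
    is active with positive probability.  Hence q pi lies between q0 and a
    constant: although pi is random and correlated with everything else, x moves
    along a positive multiple of minus the full gradient, up to the three errors
    below.  The matrix D enters the step twice, but it is idempotent, so only the
    joint mean E[A D] appears.

    The proof is a one-step mean contraction of a weighted sum of four terms:
    the distance a = |x - x*|^2; the disagreement b, the phi-variance of the
    rows of X; the staleness c = |X - C|^2; and the tracking error d, a
    quadratic form of Z.  With S = a + b + c + d, their conditional means after
    one step are at most
      (1 - eta theta) a + eta K (b + c + d) + K b + eta^2 K S   [mean_opt_err],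
      (1 - beta) b + eta^2 K S                             [mean_disagreement],
      (1 - gamma) c + K b + eta^2 K S                         [mean_staleness],
      (1 - delta) d + K c                                     [mean_track_err].
    At eta = 0 this system is triangular in the order b, c, d, a, so suitable
    weights make it contract at rate 1 - eta theta / 2 for small eta
    [weighted_contraction].

    The contraction of b is explicit: averaging with a
    row-stochastic A lowers the phi-variance by a Dirichlet form, stationarity
    of phi keeps the rest, and primitivity of E[A] yields a Poincare inequality
    [var_contraction].  For B no such formula is available, as the weights pi
    may come arbitrarily close to 0.  Instead one iterates the averaged map
    M -> E[B M B^T] on Gram matrices: it contracts the variance form, by the
    previous argument applied to B^T, and by duality E|B_k ... B_1 Z|^2 decays
    geometrically when u Z = 0; summing finitely many of these quadratic forms
    gives the Lyapunov form used in d [gossip_lyapunov].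

    Finally the state before a draw is independent of that draw
    [driven_state_independent], so Tonelli's theorem integrates the one-step
    bound and yields geometric decay of the mean.  Summability of the means
    gives almost sure convergence [geometric_means_cvg0]. *)

(** * Squared Frobenius norms *)

Section Frobenius.
Variable R : realFieldType.

Lemma sum_mul_sq_le (I : finType) (a b : I -> R) :
  (\sum_i a i * b i) ^+ 2 <= (\sum_i a i ^+ 2) * (\sum_i b i ^+ 2).
Proof.
set S := \sum_i a i ^+ 2; set T := \sum_i b i ^+ 2; set D := \sum_i a i * b i.
have T_ge0 : 0 <= T by apply: sumr_ge0 => i _; rewrite sqr_ge0.
have [T0|T_neq0] := eqVneq T 0.
  have -> : D = 0.
    apply: big1 => i _; move: T0 => /eqP.
    rewrite psumr_eq0 => [/allP/(_ i)|j _]; last exact: sqr_ge0.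
    by rewrite mem_index_enum => /(_ isT); rewrite sqrf_eq0 => /eqP ->; rewrite mulr0.
  by rewrite T0 mulr0 expr0n.
have T_gt0 : 0 < T by rewrite lt_def T_neq0.
have : 0 <= \sum_i (T * a i - D * b i) ^+ 2.
  by apply: sumr_ge0 => i _; rewrite sqr_ge0.
have -> : \sum_i (T * a i - D * b i) ^+ 2 = T * (S * T - D ^+ 2).
  transitivity (\sum_i (T ^+ 2 * a i ^+ 2 - 2 * T * D * (a i * b i) + D ^+ 2 * b i ^+ 2)).
    by apply: eq_bigr => i _; ring.
  by rewrite big_split sumrB -!mulr_sumr -/S -/T -/D /=; ring.
by rewrite pmulr_rge0// subr_ge0.
Qed.

(** The harmonic-type bound [(1 + \sum_i (F i)^-1)^-1] is an explicit witness. *)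
Lemma pos_family_lower_bound (I : finType) (F : I -> R) :
  (forall i, 0 < F i) -> exists2 d : R, 0 < d & forall i, d <= F i.
Proof.
move=> F_gt0.
have F_inv_ge0 i : 0 <= (F i)^-1 by rewrite invr_ge0 ltW.
have S_gt0 : 0 < 1 + \sum_i (F i)^-1.
  by rewrite ltr_pwDl//; apply: sumr_ge0.
exists (1 + \sum_i (F i)^-1)^-1; first by rewrite invr_gt0.
move=> i; rewrite -[leRHS]invrK lef_pV2 ?posrE ?invr_gt0//.
rewrite (bigD1 i)//= addrCA lerDl addr_ge0//.
by apply: sumr_ge0.
Qed.

Section Shape.
Variables m q : nat.
Implicit Types M N : 'M[R]_(m, q).

(** Working with squares keeps every estimate polynomial in the entries, as the
    mean bounds require. *)
Definition nsq M : R := \sum_i \sum_j M i j ^+ 2.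
Definition dotmx M N : R := \sum_i \sum_j M i j * N i j.

Lemma nsq_ge0 M : 0 <= nsq M.
Proof. by apply: sumr_ge0 => i _; apply: sumr_ge0 => j _; rewrite sqr_ge0. Qed.

Lemma nsqZ c M : nsq (c *: M) = c ^+ 2 * nsq M.
Proof.
rewrite /nsq mulr_sumr; apply: eq_bigr => i _; rewrite mulr_sumr.
by apply: eq_bigr => j _; rewrite mxE exprMn.
Qed.

Lemma nsqN M : nsq (- M) = nsq M.
Proof. by rewrite -scaleN1r nsqZ sqrrN expr1n mul1r. Qed.

Lemma dotmxNl M N : dotmx (- M) N = - dotmx M N.
Proof.
rewrite /dotmx -sumrN; apply: eq_bigr => i _; rewrite -sumrN.
by apply: eq_bigr => j _; rewrite mxE mulNr.
Qed.

Lemma dotmxC M N : dotmx M N = dotmx N M.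
Proof. by apply: eq_bigr => i _; apply: eq_bigr => j _; rewrite mulrC. Qed.

Lemma dotmxDl M1 M2 N : dotmx (M1 + M2) N = dotmx M1 N + dotmx M2 N.
Proof.
rewrite /dotmx -big_split; apply: eq_bigr => i _; rewrite -big_split /=.
by apply: eq_bigr => j _; rewrite mxE mulrDl.
Qed.

Lemma dotmxDr M N1 N2 : dotmx M (N1 + N2) = dotmx M N1 + dotmx M N2.
Proof. by rewrite dotmxC dotmxDl !(dotmxC M). Qed.

Lemma dotmxZl c M N : dotmx (c *: M) N = c * dotmx M N.
Proof.
rewrite /dotmx mulr_sumr; apply: eq_bigr => i _; rewrite mulr_sumr.
by apply: eq_bigr => j _; rewrite mxE mulrA.
Qed.

Lemma dotmxZr c M N : dotmx M (c *: N) = c * dotmx M N.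
Proof. by rewrite dotmxC dotmxZl dotmxC. Qed.

Lemma dotmx_self M : dotmx M M = nsq M.
Proof. by apply: eq_bigr => i _; apply: eq_bigr => j _; rewrite expr2. Qed.

Lemma nsqD M N : nsq (M + N) = nsq M + 2 * dotmx M N + nsq N.
Proof. by rewrite -!dotmx_self dotmxDl !dotmxDr (dotmxC N M); ring. Qed.

(** Expand the square of [e *: M - N]. *)
Lemma dotmx_young (e : R) M N : 0 < e ->
  2 * dotmx M N <= e * nsq M + e^-1 * nsq N.
Proof.
move=> e_gt0; have := nsq_ge0 (e *: M - N).
rewrite nsqD dotmxC dotmxNl dotmxC dotmxZl nsqN nsqZ => h.
rewrite -subr_ge0.
have -> : e * nsq M + e^-1 * nsq N - 2 * dotmx M N =
          e^-1 * (e ^+ 2 * nsq M + 2 * - (e * dotmx M N) + nsq N).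
  by field; rewrite gt_eqF.
by rewrite mulr_ge0// invr_ge0 ltW.
Qed.

Lemma nsqD_young (e : R) M N : 0 < e ->
  nsq (M + N) <= (1 + e) * nsq M + (1 + e^-1) * nsq N.
Proof.
move=> e_gt0; rewrite nsqD; have := dotmx_young M N e_gt0; lra.
Qed.

Lemma nsqD_le M N : nsq (M + N) <= 2 * nsq M + 2 * nsq N.
Proof. by have := nsqD_young M N ltr01; rewrite invr1; lra. Qed.

Lemma nsqB_le M N : nsq (M - N) <= 2 * nsq M + 2 * nsq N.
Proof. by rewrite -(nsqN N) nsqD_le. Qed.

Lemma sqr_le_nsq M i j : M i j ^+ 2 <= nsq M.
Proof.
rewrite /nsq (bigD1 i)//= (bigD1 j)//= -addrA lerDl addr_ge0//.
  by apply: sumr_ge0 => ? _; rewrite sqr_ge0.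
by apply: sumr_ge0 => ? _; apply: sumr_ge0 => ? _; rewrite sqr_ge0.
Qed.

(** Applies to stochastic matrices, activity matrices and push-sum weights. *)
Lemma nsq_unit_entries M : (forall i j, 0 <= M i j <= 1) -> nsq M <= m%:R * q%:R.
Proof.
move=> M01; rewrite /nsq.
apply: (@le_trans _ _ (\sum_(i < m) \sum_(j < q) 1)).
  apply: ler_sum => i _; apply: ler_sum => j _.
  by have /andP[M0 M1] := M01 i j; rewrite exprn_ile1.
by rewrite !sumr_const !card_ord -[leLHS]mulr_natl.
Qed.

End Shape.

Lemma nsq_rows m q (M : 'M[R]_(m, q)) : nsq M = \sum_i nsq (row i M).
Proof.
apply: eq_bigr => i _; rewrite /nsq big_ord1.
by apply: eq_bigr => j _; rewrite mxE.
Qed.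

Lemma nsq_row_le m q (M : 'M[R]_(m, q)) i : nsq (row i M) <= nsq M.
Proof.
rewrite [leRHS]nsq_rows (bigD1 i)//= lerDl; apply: sumr_ge0 => j _; exact: nsq_ge0.
Qed.

Lemma nsq_tr m q (M : 'M[R]_(m, q)) : nsq M^T = nsq M.
Proof.
rewrite /nsq exchange_big; apply: eq_bigr => i _; apply: eq_bigr => j _.
by rewrite mxE.
Qed.

Lemma nsqM m q r (M : 'M[R]_(m, q)) (N : 'M[R]_(q, r)) :
  nsq (M *m N) <= nsq M * nsq N.
Proof.
rewrite -(nsq_tr N) {2}/nsq mulr_suml; apply: ler_sum => i _.
rewrite {1}/nsq mulr_sumr; apply: ler_sum => k _.
rewrite mxE (le_trans (sum_mul_sq_le _ _))// ler_wpM2l//.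
  by apply: sumr_ge0 => ? _; rewrite sqr_ge0.
by apply: ler_sum => j _; rewrite mxE.
Qed.

End Frobenius.

(** * Weighted variance along a stationary chain *)

Section WeightedVariance.
Variable R : realFieldType.

Lemma mulmx_onesP m q (M : 'M[R]_(m, q)) :
  M *m (const_mx 1 : 'cV_q) = const_mx 1 <-> forall i, \sum_j M i j = 1.
Proof.
split=> [h i|h].
  have /matrixP/(_ i 0) := h; rewrite !mxE => <-.
  by apply: eq_bigr => j _; rewrite mxE mulr1.
apply/matrixP => i j; rewrite !mxE -[RHS](h i).
by apply: eq_bigr => k _; rewrite mxE mulr1.
Qed.

Lemma entry_le1 m q (M : 'M[R]_(m, q)) :
  (forall i j, 0 <= M i j) -> M *m (const_mx 1 : 'cV_q) = const_mx 1 ->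
  forall i j, M i j <= 1.
Proof.
move=> M_ge0 /mulmx_onesP M1 i j; rewrite -(M1 i) (bigD1 j)//= lerDl.
exact: sumr_ge0.
Qed.

(** A quantitative Jensen inequality.  The variance [S - m ^+ 2] dominates
    [kappa * (v i - m) ^+ 2], since index [i] alone has weight at least [kappa];
    and the spread around [v i] is the variance plus [(v i - m) ^+ 2]. *)
Lemma weighted_mean_sq n (a v : 'I_n -> R) (i : 'I_n) (kappa : R) :
  (forall j, 0 <= a j) -> \sum_j a j = 1 -> 0 < kappa -> kappa <= a i ->
  (\sum_j a j * v j) ^+ 2 <=
  \sum_j a j * v j ^+ 2 - kappa / (1 + kappa) * \sum_j a j * (v j - v i) ^+ 2.
Proof.
move=> a_ge0 a1 k_gt0 k_le; set m := \sum_j a j * v j.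
set S := \sum_j a j * v j ^+ 2.
have shift c : \sum_j a j * (v j - c) ^+ 2 = S - 2 * c * m + c ^+ 2.
  transitivity (\sum_j (a j * v j ^+ 2 - 2 * c * (a j * v j) + c ^+ 2 * a j)).
    by apply: eq_bigr => j _; ring.
  by rewrite big_split sumrB -!mulr_sumr /= a1 mulr1.
have Var : kappa * (v i - m) ^+ 2 <= S - m ^+ 2.
  have <- : \sum_j a j * (v j - m) ^+ 2 = S - m ^+ 2 by rewrite shift; ring.
  rewrite (bigD1 i)//= -[leLHS]addr0 lerD ?ler_wpM2r ?sqr_ge0//.
  by apply: sumr_ge0 => j _; rewrite mulr_ge0 ?sqr_ge0.
rewrite shift; set G := (S - _ + _).
have : kappa / (1 + kappa) * G <= S - m ^+ 2.
  rewrite mulrAC ler_pdivrMr ?addr_gt0// -subr_ge0.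
  have -> : (S - m ^+ 2) * (1 + kappa) - kappa * G
      = S - m ^+ 2 - kappa * (v i - m) ^+ 2 by rewrite /G; ring.
  by rewrite subr_ge0.
by rewrite lerBrDr -lerBrDl.
Qed.

Section Chain.
Variable n : nat.
Variables (phi : 'rV[R]_n) (M : 'M[R]_n).
Hypothesis phi_gt0 : forall i, 0 < phi 0 i.
Hypothesis phi1 : \sum_i phi 0 i = 1.
Hypothesis M_ge0 : forall i j, 0 <= M i j.
Hypothesis M1 : forall i, \sum_j M i j = 1.
Hypothesis phiM : phi *m M = phi.

Let phi_ge0 i : 0 <= phi 0 i. Proof. exact: ltW. Qed.

Lemma stationary_sum (g : 'I_n -> R) :
  \sum_i phi 0 i * \sum_j M i j * g j = \sum_i phi 0 i * g i.
Proof.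
under eq_bigr => i _ do rewrite mulr_sumr.
rewrite exchange_big; apply: eq_bigr => j _ /=.
rewrite -[in RHS]phiM mxE mulr_suml.
by apply: eq_bigr => i _; rewrite mulrA.
Qed.

Definition dirichlet (N : 'M[R]_n) (x : 'I_n -> R) :=
  \sum_i phi 0 i * \sum_j N i j * (x j - x i) ^+ 2.

Definition var (x : 'I_n -> R) := \sum_i phi 0 i * (x i - \sum_j phi 0 j * x j) ^+ 2.

Lemma var_le_shift (c : R) x : var x <= \sum_i phi 0 i * (x i - c) ^+ 2.
Proof.
rewrite /var; set m := \sum_j phi 0 j * x j; rewrite -subr_ge0.
suff -> : \sum_i phi 0 i * (x i - c) ^+ 2 - \sum_i phi 0 i * (x i - m) ^+ 2
    = (m - c) ^+ 2 by exact: sqr_ge0.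
transitivity (\sum_i (2 * (m - c) * (phi 0 i * x i) + (c ^+ 2 - m ^+ 2) * phi 0 i)).
  by rewrite -sumrB; apply: eq_bigr => i _; ring.
by rewrite big_split -!mulr_sumr /= phi1 -/m; ring.
Qed.

Lemma expr_stochastic k :
  (forall i j, 0 <= (M ^+ k) i j) /\ forall i, \sum_j (M ^+ k) i j = 1.
Proof.
elim: k => [|k [IH0 IH1]].
  split=> [i j|i]; rewrite ?expr0; first by rewrite mxE ler0n.
  rewrite (bigD1 i)//= mxE eqxx big1 ?addr0// => j /negPf ji.
  by rewrite mxE eq_sym ji.
split=> [i j|i]; rewrite exprS.
  by rewrite mxE; apply: sumr_ge0 => l _; rewrite mulr_ge0.
under eq_bigr => j _ do rewrite mxE.
rewrite exchange_big -[RHS](M1 i) /=; apply: eq_bigr => l _.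
by rewrite -mulr_sumr IH1 mulr1.
Qed.

Lemma dirichlet_ge0 x : 0 <= dirichlet M x.
Proof.
apply: sumr_ge0 => i _; rewrite mulr_ge0// sumr_ge0// => j _.
by rewrite mulr_ge0// sqr_ge0.
Qed.

(** In [k] steps a stationary chain moves, in mean square, at most a constant
    times as much as in one step: split the first step off with
    [(a + b) ^+ 2 <= 2 a ^+ 2 + 2 b ^+ 2] and use stationarity for the rest. *)
Lemma dirichlet_expr k x : dirichlet (M ^+ k) x <= 4 ^+ k * dirichlet M x.
Proof.
elim: k => [|k IH].
  rewrite expr0 mul1r [leLHS]big1 ?dirichlet_ge0// => i _.
  rewrite big1 ?mulr0// => j _; rewrite mxE.
  by have [->|_] := eqVneq i j; rewrite ?subrr ?expr0n ?mulr0 ?mul0r.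
have [Mk_ge0 Mk1] := expr_stochastic k.
have step : dirichlet (M ^+ k.+1) x <= 2 * dirichlet M x + 2 * dirichlet (M ^+ k) x.
  rewrite /dirichlet -(stationary_sum (fun i => \sum_j (M ^+ k) i j * (x j - x i) ^+ 2)).
  rewrite !mulr_sumr -big_split; apply: ler_sum => i _ /=.
  rewrite !(mulrCA 2) -mulrDr ler_wpM2l// exprS.
  have -> : \sum_j (M * M ^+ k) i j * (x j - x i) ^+ 2 =
      \sum_l \sum_j M i l * (M ^+ k) l j * (x j - x i) ^+ 2.
    by rewrite exchange_big; apply: eq_bigr => j _; rewrite mxE mulr_suml.
  rewrite !mulr_sumr -big_split; apply: ler_sum => l _ /=.
  have -> : M i l * (x l - x i) ^+ 2 =
      \sum_j M i l * (x l - x i) ^+ 2 * (M ^+ k) l j by rewrite -mulr_sumr Mk1 mulr1.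
  rewrite !mulr_sumr -big_split; apply: ler_sum => j _ /=.
  apply: (@le_trans _ _ (M i l * (M ^+ k) l j *
      (2 * (x l - x i) ^+ 2 + 2 * (x j - x l) ^+ 2))); last first.
    by rewrite le_eqVlt; apply/orP; left; apply/eqP; ring.
  rewrite ler_wpM2l ?mulr_ge0// -subr_ge0.
  have -> : 2 * (x l - x i) ^+ 2 + 2 * (x j - x l) ^+ 2 - (x j - x i) ^+ 2
    = (2 * x l - x i - x j) ^+ 2 by ring.
  exact: sqr_ge0.
apply: (le_trans step); rewrite exprS -mulrA.
have : dirichlet M x <= 4 ^+ k * dirichlet M x.
  by rewrite ler_peMl ?dirichlet_ge0// exprn_ege1// ler1n.
lra.
Qed.

(** The Poincare inequality of a primitive chain: a power with all entries at
    least [d] compares its Dirichlet form with the variance. *)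
Lemma var_le_dirichlet (d : R) k x : 0 < d -> (forall i j, d <= (M ^+ k) i j) ->
  var x <= 4 ^+ k / d * dirichlet M x.
Proof.
move=> d_gt0 dle; rewrite mulrAC ler_pdivlMr//.
apply: le_trans (dirichlet_expr k x); rewrite mulrC mulr_sumr.
apply: ler_sum => i _; rewrite mulrCA ler_wpM2l//.
apply: (@le_trans _ _ (d * \sum_j phi 0 j * (x j - x i) ^+ 2)).
  rewrite ler_pM2l//.
  have -> : x i - \sum_j phi 0 j * x j = - \sum_j phi 0 j * (x j - x i).
    under [in RHS]eq_bigr => j _ do rewrite mulrBr.
    by rewrite sumrB -mulr_suml phi1 mul1r opprB.
  have := @weighted_mean_sq n (fun j => phi 0 j) (fun j => x j - x i).
  move=> /(_ i (phi 0 i) phi_ge0 phi1 (phi_gt0 i) (lexx _)); rewrite sqrrN => h.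
  apply: le_trans h _.
  rewrite gerBl mulr_ge0 ?divr_ge0 ?addr_ge0 ?sumr_ge0// => l _.
  by rewrite mulr_ge0 ?sqr_ge0.
rewrite mulr_sumr; apply: ler_sum => j _; rewrite mulrA ler_wpM2r ?sqr_ge0//.
apply: le_trans (dle i j); rewrite ger_pMr// -phi1 (bigD1 j)//= lerDl.
exact: sumr_ge0.
Qed.

End Chain.

(** A left fixed vector [v] exists because [M - 1] kills the all-ones column.
    The entrywise absolute value [w] of [v] satisfies [w <= w *m M], with equal
    total sums, so it is fixed too; a positive power of [M] makes it positive. *)
Lemma stationary_distribution n (M : 'M[R]_n) k :
  (forall i j, 0 <= M i j) -> (forall i, \sum_j M i j = 1) ->
  (forall i j, 0 < (M ^+ k) i j) -> (0 < n)%N ->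
  exists phi : 'rV[R]_n,
    [/\ forall i, 0 < phi 0 i, \sum_i phi 0 i = 1 & phi *m M = phi].
Proof.
move=> M_ge0 M1 Mk_gt0 n_gt0.
have [v v_neq0 vM] : exists2 v : 'rV[R]_n, v != 0 & v *m M = v.
  have : kermx (M - 1%:M) != 0.
    rewrite kermx_eq0 /row_free; apply/negP => /eqP full.
    have inv : M - 1%:M \in unitmx by rewrite -row_free_unit /row_free full.
    have /(congr1 (mulmx (invmx (M - 1%:M)))) :
        (M - 1%:M) *m (const_mx 1 : 'cV[R]_n) = 0.
      rewrite mulmxBl mul1mx; apply/eqP; rewrite subr_eq0; exact/eqP/mulmx_onesP.
    rewrite mulKmx// mulmx0 => /matrixP/(_ (Ordinal n_gt0) 0)/eqP.
    by rewrite !mxE oner_eq0.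
  move=> /rowV0Pn[v /sub_kermxP]; rewrite mulmxBr mulmx1 => /eqP.
  by rewrite subr_eq0 => /eqP vM v0; exists v.
pose w : 'rV[R]_n := \row_j `|v 0 j|.
have wM_ge j : w 0 j <= (w *m M) 0 j.
  rewrite mxE -{1}vM mxE (le_trans (ler_norm_sum _ _ _))//.
  by rewrite mxE; apply: ler_sum => i _; rewrite normrM (ger0_norm (M_ge0 _ _)) mxE.
have wM : w *m M = w.
  have sum_eq : \sum_j ((w *m M) 0 j - w 0 j) = 0.
    rewrite sumrB; under eq_bigr => j _ do rewrite mxE.
    rewrite exchange_big /=.
    under eq_bigr => i _ do rewrite -mulr_sumr M1 mulr1.
    by rewrite subrr.
  apply/rowP => j; apply/eqP; rewrite -subr_eq0; move: sum_eq => /eqP.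
  rewrite psumr_eq0 => [/allP/(_ j)|i _]; last by rewrite subr_ge0.
  by rewrite mem_index_enum; exact.
have wMk : w *m M ^+ k = w.
  by elim: k {Mk_gt0} => [|k IH]; rewrite ?expr0 ?mulmx1// exprSr mulmxA IH wM.
have w_ge0 i : 0 <= w 0 i by rewrite mxE.
have [i0 wi0] : exists i0, 0 < w 0 i0.
  by move/rV0Pn: v_neq0 => [i0 vi0]; exists i0; rewrite mxE normr_gt0.
have w_gt0 j : 0 < w 0 j.
  rewrite -wMk mxE (bigD1 i0)//= ltr_pwDl ?mulr_gt0// sumr_ge0// => i _.
  by rewrite mulr_ge0// ltW.
have S_gt0 : 0 < \sum_i w 0 i.
  by rewrite (bigD1 i0)//= ltr_pwDl// sumr_ge0.
exists ((\sum_i w 0 i)^-1 *: w); split.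
- by move=> i; rewrite mxE mulr_gt0// invr_gt0.
- by under eq_bigr => i _ do rewrite mxE; rewrite -mulr_sumr mulVf// gt_eqF.
- by rewrite -scalemxAl wM.
Qed.

End WeightedVariance.

(** * Upper expectations *)

Section Mean.
Context d (T : measurableType d) (R : realType) (P : probability T R).
Implicit Types (g h : T -> R).

Definition ess_bounded g :=
  measurable_fun setT g /\ exists C : R, {ae P, forall w, `|g w| <= C}.

Notation int_fun g := (P.-integrable setT (EFin \o g)).

Lemma Rint_cst (c : R) : \int[P]_w c = c.
Proof. by rewrite Rintegral_cst//= probability_setT mulr1. Qed.

Lemma int_funD g h : int_fun g -> int_fun h -> int_fun (fun w => g w + h w).
Proof.
move=> ig ih; have := integrableD measurableT ig ih.
by apply: eq_integrable => // w _ /=; rewrite EFinD.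
Qed.

Lemma int_funZ (k : R) g : int_fun g -> int_fun (fun w => k * g w).
Proof.
move=> ig; have := integrableZl measurableT k ig.
by apply: eq_integrable => // w _ /=; rewrite EFinM.
Qed.

Lemma int_funB g h : int_fun g -> int_fun h -> int_fun (fun w => g w - h w).
Proof.
move=> ig ih; have := integrableB measurableT ig ih.
by apply: eq_integrable => // w _ /=; rewrite EFinB.
Qed.

Lemma ess_bounded_integrable g : ess_bounded g -> int_fun g.
Proof.
move=> [mg [C gC]]; apply/integrableP; split; first exact/measurable_EFinP.
apply: (@le_lt_trans _ _ (\int[P]_w `|C|%:E)%E).
  apply: ae_ge0_le_integral => //.
  - by apply: measurableT_comp => //; exact/measurable_EFinP.
  - by move: gC; apply: filterS => w h _ /=; rewrite lee_fin (le_trans h)// ler_norm.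
by rewrite integral_cst//= probability_setT mule1 ltry.
Qed.

Lemma ess_bounded_cst (c : R) : ess_bounded (fun=> c).
Proof. by split=> //; exists `|c|; exact: aeW. Qed.

Lemma ess_boundedD g h : ess_bounded g -> ess_bounded h -> ess_bounded (fun w => g w + h w).
Proof.
move=> [mg [C gC]] [mh [D hD]]; split; first exact: measurable_funD.
exists (C + D); move: gC hD; apply: filterS2 => w hg hh.
exact: le_trans (ler_normD _ _) (lerD hg hh).
Qed.

Lemma ess_boundedM g h : ess_bounded g -> ess_bounded h -> ess_bounded (fun w => g w * h w).
Proof.
move=> [mg [C gC]] [mh [D hD]]; split; first exact: measurable_funM.
exists (C * D); move: gC hD; apply: filterS2 => w hg hh.
by rewrite normrM ler_pM.
Qed.

Lemma ess_bounded_sum (I : finType) (F : I -> T -> R) :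
  (forall i, ess_bounded (F i)) -> ess_bounded (fun w => \sum_i F i w).
Proof.
move=> hF; elim: (index_enum I) => [|i r IH].
  by under eq_fun do rewrite big_nil; exact: ess_bounded_cst.
by under eq_fun do rewrite big_cons; apply: ess_boundedD.
Qed.

Lemma Rint_sum (I : finType) (F : I -> T -> R) :
  (forall i, int_fun (F i)) ->
  int_fun (fun w => \sum_i F i w) /\ \int[P]_w (\sum_i F i w) = \sum_i \int[P]_w F i w.
Proof.
move=> hF; elim: (index_enum I) => [|i r [IHi IH]].
  rewrite (_ : (fun w => \sum_(i <- [::]) F i w) = fun=> 0); last first.
    by apply/funext => w; rewrite big_nil.
  rewrite big_nil; split; first exact/ess_bounded_integrable/ess_bounded_cst.
  by rewrite Rint_cst.
rewrite (_ : (fun w => \sum_(j <- i :: r) F j w)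
           = fun w => F i w + \sum_(j <- r) F j w); last first.
  by apply/funext => w; rewrite big_cons.
rewrite big_cons; split; last by rewrite RintegralD// IH.
exact: int_funD.
Qed.

Lemma le_ae_Rint g h : int_fun g -> int_fun h -> {ae P, forall w, g w <= h w} ->
  \int[P]_w g w <= \int[P]_w h w.
Proof.
move=> ig ih gh; rewrite -subr_ge0 -RintegralB//.
have ihg : int_fun (fun w => h w - g w) by exact: int_funB.
rewrite /Rintegral fine_ge0//.
rewrite (@ae_eq_integral _ _ _ P setT (fun w => `|h w - g w|%:E))//.
- by apply: integral_ge0 => w _; rewrite lee_fin.
- exact: (measurable_int P).
- by have /integrable_norm := ihg; exact: (measurable_int P).
- by move: gh; apply: filterS => w ghw _; rewrite ger0_norm// subr_ge0.
Qed.

(** An integrable majorant with mean at most [c].  The lemmas below bound the mean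
    of a nonlinear quantity by bounding it almost surely by random terms whose
    means are known, without measurability conditions on the quantity itself. *)
Definition mean_le g (c : R) :=
  exists h, [/\ int_fun h, {ae P, forall w, g w <= h w} & \int[P]_w h w <= c].

Lemma mean_le_cst (c : R) : mean_le (fun=> c) c.
Proof.
exists (fun=> c); split => //; first exact/ess_bounded_integrable/ess_bounded_cst.
  exact: aeW.
by rewrite Rint_cst.
Qed.

Lemma mean_le_int h : int_fun h -> mean_le h (\int[P]_w h w).
Proof. by move=> ih; exists h; split=> //; exact: aeW. Qed.

Lemma mean_leD g h b c : mean_le g b -> mean_le h c ->
  mean_le (fun w => g w + h w) (b + c).
Proof.
move=> [g' [ig gg' bg]] [h' [ih hh' ch]]; exists (fun w => g' w + h' w); split.
- exact: int_funD.
- by move: gg' hh'; apply: filterS2 => w; exact: lerD.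
- by rewrite RintegralD// lerD.
Qed.

Lemma mean_leZ (k : R) g c : 0 <= k -> mean_le g c -> mean_le (fun w => k * g w) (k * c).
Proof.
move=> k0 [g' [ig gg' cg]]; exists (fun w => k * g' w); split.
- exact: int_funZ.
- by move: gg'; apply: filterS => w; exact: ler_wpM2l.
- by rewrite RintegralZl// ler_wpM2l.
Qed.

Lemma mean_le_ae g h c : {ae P, forall w, g w <= h w} -> mean_le h c -> mean_le g c.
Proof.
move=> gh [h' [ih hh' ch]]; exists h'; split=> //.
by move: gh hh'; apply: filterS2 => w; exact: le_trans.
Qed.

Lemma mean_le_ub g b c : b <= c -> mean_le g b -> mean_le g c.
Proof. by move=> bc [h [ih gh hb]]; exists h; split=> //; exact: le_trans bc. Qed.

Lemma mean_le_sum (I : finType) (F : I -> T -> R) (c : I -> R) :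
  (forall i, mean_le (F i) (c i)) -> mean_le (fun w => \sum_i F i w) (\sum_i c i).
Proof.
move=> hF; elim: (index_enum I) => [|i r IH].
  rewrite (_ : (fun w => \sum_(i <- [::]) F i w) = fun=> 0); last first.
    by apply/funext => w; rewrite big_nil.
  rewrite big_nil; exact: mean_le_cst.
rewrite (_ : (fun w => \sum_(j <- i :: r) F j w)
           = fun w => F i w + \sum_(j <- r) F j w); last first.
  by apply/funext => w; rewrite big_cons.
by rewrite big_cons; exact: mean_leD.
Qed.

Lemma mean_le_Rint g c : int_fun g -> mean_le g c -> \int[P]_w g w <= c.
Proof. by move=> ig [h [ih gh hc]]; exact: le_trans (le_ae_Rint ig ih gh) hc. Qed.

Lemma mean_le_ge0_integral g c : measurable_fun setT g -> (forall w, 0 <= g w) ->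
  mean_le g c -> (\int[P]_w (g w)%:E <= c%:E)%E.
Proof.
move=> mg g0 [h [ih gh hc]].
apply: (@le_trans _ _ (\int[P]_w `|h w|%:E)%E).
  apply: ae_ge0_le_integral => //.
  - by move=> w _; rewrite lee_fin.
  - exact/measurable_EFinP.
  - by have /integrable_norm := ih; exact: (measurable_int P).
  - by move: gh; apply: filterS => w gw _; rewrite lee_fin (le_trans gw)// ler_norm.
rewrite (@ae_eq_integral _ _ _ P setT (EFin \o h))//.
- by rewrite -[leLHS]fineK ?lee_fin//; exact: integrable_fin_num.
- by have /integrable_norm := ih; exact: (measurable_int P).
- exact: (measurable_int P).
- move: gh; apply: filterS => w gw _ /=; rewrite ger0_norm//.
  exact: le_trans (g0 w) gw.
Qed.

End Mean.

(** * Quadratic forms of the rows *)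

Section QuadraticForm.
Variable R : realFieldType.

(** The form of [Q] summed over the columns of [X]; being linear in the Gram
    matrix [X *m X^T], it commutes with means. *)
Definition qf n q (Q : 'M[R]_n) (X : 'M[R]_(n, q)) : R := \tr (Q *m (X *m X^T)).

Lemma trace_mul_tr m q (M N : 'M[R]_(m, q)) : \tr (M *m N^T) = dotmx M N.
Proof.
apply: eq_bigr => i _; rewrite mxE; apply: eq_bigr => j _.
by rewrite mxE.
Qed.

Lemma qf_dot n q (Q : 'M[R]_n) (X : 'M[R]_(n, q)) : qf Q X = dotmx (Q *m X) X.
Proof. by rewrite /qf mulmxA trace_mul_tr. Qed.

Lemma qf1 n q (X : 'M[R]_(n, q)) : qf 1%:M X = nsq X.
Proof. by rewrite qf_dot mul1mx dotmx_self. Qed.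

Lemma qfZ n q (Q : 'M[R]_n) c (X : 'M[R]_(n, q)) : qf Q (c *: X) = c ^+ 2 * qf Q X.
Proof. by rewrite !qf_dot -scalemxAr dotmxZl dotmxZr mulrA. Qed.

Lemma qf_sum n q (I : finType) (Q : I -> 'M[R]_n) (X : 'M[R]_(n, q)) :
  qf (\sum_i Q i) X = \sum_i qf (Q i) X.
Proof. by rewrite /qf mulmx_suml raddf_sum. Qed.

Lemma qf_le_nsq n q (Q : 'M[R]_n) (X : 'M[R]_(n, q)) :
  qf Q X <= (1 + nsq Q) * nsq X.
Proof.
have h1 := dotmx_young (Q *m X) X (@ltr01 R).
have h2 := nsqM Q X; have h3 := nsq_ge0 X; have h4 := nsq_ge0 (Q *m X).
rewrite qf_dot; rewrite invr1 in h1; lra.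
Qed.

(** Expand the form at [e *: U - V]. *)
Lemma qf_young n q (Q : 'M[R]_n) (e : R) (U V : 'M[R]_(n, q)) :
  (forall X : 'M[R]_(n, q), 0 <= qf Q X) -> 0 < e ->
  qf Q (U + V) <= (1 + e) * qf Q U + (1 + e^-1) * qf Q V.
Proof.
move=> Q_ge0 e_gt0; have := Q_ge0 (e *: U - V).
pose c := dotmx (Q *m U) V + dotmx (Q *m V) U.
have -> : qf Q (e *: U - V) = e ^+ 2 * qf Q U - e * c + qf Q V.
  rewrite !qf_dot -scaleN1r mulmxDr -!scalemxAr.
  by rewrite !(dotmxDl, dotmxDr, dotmxZl, dotmxZr) /c; ring.
have -> : qf Q (U + V) = qf Q U + c + qf Q V.
  by rewrite !qf_dot mulmxDr dotmxDl !dotmxDr /c; ring.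
move=> h; rewrite -subr_ge0.
have -> : (1 + e) * qf Q U + (1 + e^-1) * qf Q V - (qf Q U + c + qf Q V)
    = e^-1 * (e ^+ 2 * qf Q U - e * c + qf Q V) by field; rewrite gt_eqF.
by rewrite mulr_ge0// invr_ge0 ltW.
Qed.

Definition var_mx n (phi : 'rV[R]_n) : 'M[R]_n := diag_mx phi - phi^T *m phi.

Lemma qf_var_mx n q (phi : 'rV[R]_n) (X : 'M[R]_(n, q)) : \sum_i phi 0 i = 1 ->
  qf (var_mx phi) X = \sum_k var phi (X ^~ k).
Proof.
move=> phi1; rewrite qf_dot /var_mx mulmxBl dotmxDl dotmxNl.
have -> : dotmx (phi^T *m phi *m X) X = \sum_k (\sum_j phi 0 j * X j k) ^+ 2.
  rewrite -mulmxA /dotmx exchange_big; apply: eq_bigr => k _ /=.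
  rewrite expr2 {1}[X in _ = X * _](eq_bigr (fun j => phi 0 j * X j k))//.
  rewrite mulr_suml; apply: eq_bigr => i _.
  by rewrite mxE big_ord1 !mxE mulrAC.
rewrite /dotmx exchange_big -sumrB; apply: eq_bigr => k _ /=.
rewrite /var; set m := \sum_j phi 0 j * X j k.
transitivity (\sum_i (phi 0 i * X i k ^+ 2 - 2 * m * (phi 0 i * X i k) + m ^+ 2 * phi 0 i)).
  rewrite big_split sumrB -!mulr_sumr phi1 /= -/m.
  have -> : \sum_i (diag_mx phi *m X) i k * X i k = \sum_i phi 0 i * X i k ^+ 2.
    by apply: eq_bigr => i _; rewrite mul_diag_mx mxE; ring.
  ring.
by apply: eq_bigr => i _; ring.
Qed.

Lemma var_ge0 n (phi : 'rV[R]_n) x : (forall i, 0 < phi 0 i) -> 0 <= var phi x.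
Proof. by move=> h; apply: sumr_ge0 => i _; rewrite mulr_ge0 ?sqr_ge0// ltW. Qed.

Lemma qf_var_mx_ge0 n q (phi : 'rV[R]_n) (X : 'M[R]_(n, q)) :
  (forall i, 0 < phi 0 i) -> \sum_i phi 0 i = 1 -> 0 <= qf (var_mx phi) X.
Proof. by move=> h0 h1; rewrite qf_var_mx//; apply: sumr_ge0 => k _; exact: var_ge0. Qed.

Lemma nsq_centered_le n q (phi : 'rV[R]_n) (X : 'M[R]_(n, q)) (d : R) :
  \sum_i phi 0 i = 1 -> 0 < d -> (forall i, d <= phi 0 i) ->
  nsq (X - const_mx 1 *m (phi *m X)) <= d^-1 * qf (var_mx phi) X.
Proof.
move=> phi1 d_gt0 dle; rewrite mulrC ler_pdivlMr// qf_var_mx// /nsq mulrC.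
rewrite exchange_big mulr_sumr; apply: ler_sum => k _ /=.
rewrite mulr_sumr; apply: ler_sum => i _.
have -> : (X - const_mx 1 *m (phi *m X)) i k = X i k - \sum_j phi 0 j * X j k.
  by rewrite !mxE big_ord1 !mxE mul1r.
by rewrite ler_wpM2r// sqr_ge0.
Qed.

Lemma trace_qf n (Q : 'M[R]_n) :
  \tr Q = \sum_i qf Q (delta_mx i 0 : 'cV[R]_n).
Proof.
apply: eq_bigr => i _.
rewrite qf_dot -colE /dotmx (bigD1 i)//= big_ord1 !mxE !eqxx mulr1.
rewrite big1 ?addr0// => j /negPf ji.
by rewrite big_ord1 !mxE ji mulr0.
Qed.

(** For a matrix with zero column sums, only the deviation of [x] from a
    constant matters in [x^T *m Z]. *)
Lemma qf_gram_le n q (psi : 'rV[R]_n) (Z : 'M[R]_(n, q)) (d : R) (x : 'cV[R]_n) :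
  \sum_i psi 0 i = 1 -> 0 < d -> (forall i, d <= psi 0 i) ->
  (const_mx 1 : 'rV[R]_n) *m Z = 0 ->
  qf (Z *m Z^T) x <= nsq Z / d * qf (var_mx psi) x.
Proof.
move=> psi1 d_gt0 dle Z0.
have -> : qf (Z *m Z^T) x = nsq (x^T *m Z).
  rewrite /qf -[nsq _]dotmx_self -trace_mul_tr trmx_mul trmxK.
  by rewrite mulmxA mxtrace_mulC !mulmxA.
have -> : x^T *m Z = (x - const_mx 1 *m (psi *m x))^T *m Z.
  rewrite linearB /= mulmxBl trmx_mul trmx_const -mulmxA Z0 mulmx0.
  by rewrite subr0.
apply: le_trans (nsqM _ _) _; rewrite nsq_tr mulrC -mulrA ler_wpM2l ?nsq_ge0//.
exact: nsq_centered_le.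
Qed.

End QuadraticForm.

Lemma expr_small (R : archiRealFieldType) (r c : R) : 0 <= r -> r < 1 -> 0 < c ->
  exists k : nat, r ^+ k <= c.
Proof.
move=> r_ge0 r_lt1 c_gt0.
have [->|r_neq0] := eqVneq r 0; first by exists 1%N; rewrite expr1 ltW.
have r_gt0 : 0 < r by rewrite lt_def r_neq0.
have y_gt0 : 0 < r^-1 - 1 by rewrite subr_gt0 invf_gt1.
pose k := Num.bound (c^-1 / (r^-1 - 1)).
exists k.
have bern : 1 + k%:R * (r^-1 - 1) <= r^-1 ^+ k.
  elim: k => [|k IH]; first by rewrite mul0r addr0 expr0.
  have h : 0 <= k%:R * (r^-1 - 1) by rewrite mulr_ge0 ?ler0n// ltW.
  have h2 : 0 <= (r^-1 - 1) * (k%:R * (r^-1 - 1)) by rewrite mulr_ge0// ltW.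
  have h3 : r^-1 * (1 + k%:R * (r^-1 - 1)) <= r^-1 * r^-1 ^+ k.
    by rewrite ler_wpM2l// invr_ge0.
  rewrite exprS -natr1; lra.
have : c^-1 <= k%:R * (r^-1 - 1).
  rewrite -ler_pdivrMr// ltW//; apply: archi_boundP.
  by rewrite divr_ge0// ?invr_ge0 ltW.
move=> h; rewrite -[leRHS]invrK -[leLHS]invrK lef_pV2 ?posrE ?invr_gt0 ?exprn_gt0//.
rewrite -exprVn; lra.
Qed.

(** * Mean contraction by random stochastic matrices *)

Section RandomMatrix.
Context d (T : measurableType d) (R : realType) (P : probability T R).

Definition ess_bounded_mx m q (M : T -> 'M[R]_(m, q)) :=
  forall i j, ess_bounded P (fun w => M w i j).

Lemma ess_bounded_mxM m q r (M : T -> 'M[R]_(m, q)) (N : T -> 'M[R]_(q, r)) :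
  ess_bounded_mx M -> ess_bounded_mx N -> ess_bounded_mx (fun w => M w *m N w).
Proof.
move=> hM hN i j; under eq_fun do rewrite mxE.
by apply: ess_bounded_sum => k; exact: ess_boundedM.
Qed.

Lemma ess_bounded_mx_cst m q (M : 'M[R]_(m, q)) : ess_bounded_mx (fun=> M).
Proof. by move=> i j; exact: ess_bounded_cst. Qed.

Lemma ess_bounded_mx_tr m q (M : T -> 'M[R]_(m, q)) :
  ess_bounded_mx M -> ess_bounded_mx (fun w => (M w)^T).
Proof. by move=> hM i j; under eq_fun do rewrite mxE; exact: hM. Qed.

Lemma mean_mxE n (M : T -> 'M[R]_n) i j : mean_mx P M i j = \int[P]_w M w i j.
Proof. by rewrite mxE unlock. Qed.

Lemma mean_trace n (M : T -> 'M[R]_n) (N : 'M[R]_n) : ess_bounded_mx M ->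
  P.-integrable setT (EFin \o (fun w => \tr (M w *m N))) /\
  \int[P]_w \tr (M w *m N) = \tr (mean_mx P M *m N).
Proof.
move=> hM.
have int1 i j : P.-integrable setT (EFin \o (fun w => M w i j * N j i)).
  apply: ess_bounded_integrable; apply: ess_boundedM => //.
  exact: ess_bounded_cst.
have int2 i : P.-integrable setT (EFin \o (fun w => \sum_j M w i j * N j i)).
  by apply: (Rint_sum _).1.
have -> : (fun w => \tr (M w *m N)) = fun w => \sum_i \sum_j M w i j * N j i.
  by apply/funext => w; apply: eq_bigr => i _; rewrite mxE.
have [h1 h2] := Rint_sum int2; split => //.
rewrite h2; apply: eq_bigr => i _; rewrite (Rint_sum (int1 i)).2 mxE.
apply: eq_bigr => j _; rewrite mean_mxE.
rewrite RintegralZr//; exact: ess_bounded_integrable.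
Qed.

(** Averaged action of [B] on quadratic forms, and its adjoint, the averaged
    action on Gram matrices. *)
Definition form_step n (B : T -> 'M[R]_n) (Q : 'M[R]_n) : 'M[R]_n :=
  mean_mx P (fun w => (B w)^T *m Q *m B w).

Definition gram_step n (B : T -> 'M[R]_n) (M : 'M[R]_n) : 'M[R]_n :=
  mean_mx P (fun w => B w *m M *m (B w)^T).

Lemma ess_bounded_form n (B : T -> 'M[R]_n) (Q : 'M[R]_n) : ess_bounded_mx B ->
  ess_bounded_mx (fun w => (B w)^T *m Q *m B w).
Proof.
move=> hB; apply: ess_bounded_mxM => //; apply: ess_bounded_mxM.
  exact: ess_bounded_mx_tr.
exact: ess_bounded_mx_cst.
Qed.

Lemma mean_qf n q (B : T -> 'M[R]_n) (Q : 'M[R]_n) (X : 'M[R]_(n, q)) :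
  ess_bounded_mx B ->
  P.-integrable setT (EFin \o (fun w => qf Q (B w *m X))) /\
  \int[P]_w qf Q (B w *m X) = qf (form_step B Q) X.
Proof.
move=> hB.
have -> : (fun w => qf Q (B w *m X)) = fun w => \tr ((B w)^T *m Q *m B w *m (X *m X^T)).
  apply/funext => w; rewrite /qf trmx_mul !mulmxA mxtrace_mulC !mulmxA.
  by [].
exact: mean_trace (X *m X^T) (ess_bounded_form Q hB).
Qed.

(** Cyclicity of the trace, under the mean. *)
Lemma form_gram_dual n (B : T -> 'M[R]_n) (Q M : 'M[R]_n) : ess_bounded_mx B ->
  \tr (form_step B Q *m M) = \tr (Q *m gram_step B M).
Proof.
move=> hB; rewrite -(mean_trace M (ess_bounded_form Q hB)).2.
rewrite [in RHS]mxtrace_mulC.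
have hBt : ess_bounded_mx (fun w => B w *m M *m (B w)^T).
  apply: ess_bounded_mxM; last exact: ess_bounded_mx_tr.
  by apply: ess_bounded_mxM => //; exact: ess_bounded_mx_cst.
rewrite -(mean_trace Q hBt).2; apply: eq_Rintegral => w _.
by rewrite -mulmxA mxtrace_mulC !mulmxA.
Qed.

Lemma form_gram_dual_iter n (B : T -> 'M[R]_n) (Q M : 'M[R]_n) k : ess_bounded_mx B ->
  \tr (iter k (form_step B) Q *m M) = \tr (Q *m iter k (gram_step B) M).
Proof.
by move=> hB; elim: k M => [//|k IH] M; rewrite iterS form_gram_dual// IH -iterSr.
Qed.

Lemma qf_gram_step n (B : T -> 'M[R]_n) (M : 'M[R]_n) (x : 'cV[R]_n) : ess_bounded_mx B ->
  P.-integrable setT (EFin \o (fun w => qf M ((B w)^T *m x))) /\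
  \int[P]_w qf M ((B w)^T *m x) = qf (gram_step B M) x.
Proof.
move=> hB; have [h1 h2] := mean_qf M x (ess_bounded_mx_tr hB).
split=> //; rewrite h2 /form_step /gram_step; congr (qf (mean_mx P _) x).
by apply/funext => w; rewrite trmxK.
Qed.

Lemma mean_row_stochastic n (M : T -> 'M[R]_n) : ess_bounded_mx M ->
  {ae P, forall w, row_stochastic (M w)} ->
  (forall i j, 0 <= mean_mx P M i j) /\ forall i, \sum_j mean_mx P M i j = 1.
Proof.
move=> hM Mst.
have intM i j : P.-integrable setT (EFin \o (fun w => M w i j)).
  exact/ess_bounded_integrable.
split=> [i j|i].
  rewrite mean_mxE -(Rint_cst P 0); apply: le_ae_Rint => //.
    exact/ess_bounded_integrable/ess_bounded_cst.
  by move: Mst; apply: filterS => w [].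
under eq_bigr => j _ do rewrite mean_mxE.
rewrite -(Rint_sum (intM i)).2 -[RHS](Rint_cst P 1); apply/eqP; rewrite eq_le.
have i1 := ess_bounded_integrable (ess_bounded_cst P 1).
have iM := (Rint_sum (intM i)).1.
by apply/andP; split; apply: le_ae_Rint => //; move: Mst; apply: filterS => w [_ /mulmx_onesP/(_ i) ->].
Qed.

(** By [weighted_mean_sq], applied to row [i] with its diagonal entry as the
    distinguished weight, the variance after averaging is at most an expression
    that is linear in the entries of [M w].  Its mean is the old variance, by
    stationarity, minus a multiple of the Dirichlet form. *)
Lemma var_contraction n (M : T -> 'M[R]_n) (phi : 'rV[R]_n) (kappa : R) :
  ess_bounded_mx M -> {ae P, forall w, row_stochastic (M w)} ->
  primitive_mx (mean_mx P M) -> 0 < kappa ->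
  {ae P, forall w, forall i, kappa <= M w i i} ->
  (forall i, 0 < phi 0 i) -> \sum_i phi 0 i = 1 -> phi *m mean_mx P M = phi ->
  exists2 b : R, 0 < b <= 2^-1 & forall q (X : 'M[R]_(n, q)),
    mean_le P (fun w => qf (var_mx phi) (M w *m X)) ((1 - b) * qf (var_mx phi) X).
Proof.
move=> hM Mst [_ [k k1 Mk_gt0]] k_gt0 Mdiag phi_gt0 phi1 phiM.
have intM i j : P.-integrable setT (EFin \o (fun w => M w i j)).
  exact/ess_bounded_integrable.
have [d0 d0_gt0 dle] := @pos_family_lower_bound R ('I_n * 'I_n)%type
  (fun ij => (mean_mx P M ^+ k) ij.1 ij.2) (fun ij => Mk_gt0 _ _).
have [M_ge0 M1] := mean_row_stochastic hM Mst.
pose kap := kappa / (1 + kappa).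
have kap_gt0 : 0 < kap by rewrite divr_gt0// addr_gt0.
pose b0 := kap * (d0 / 4 ^+ k).
have b0_gt0 : 0 < b0 by rewrite mulr_gt0// divr_gt0// exprn_gt0.
exists (Num.min b0 2^-1).
  by rewrite ge_min lexx orbT lt_min b0_gt0 invr_gt0 ltr0n.
move=> q X; rewrite qf_var_mx// mulr_sumr.
under eq_fun do rewrite qf_var_mx//.
apply: mean_le_sum => l; set x := X ^~ l; set m := \sum_j phi 0 j * x j.
apply: (@mean_le_ae _ _ _ _ _ (fun w => \sum_i phi 0 i * (\sum_j M w i j * x j - m) ^+ 2)).
  apply: aeW => w; apply: le_trans (var_le_shift phi1 m _) _.
  by apply: ler_sum => i _; rewrite mxE.
pose c i j := phi 0 i * ((x j - m) ^+ 2 - kap * (x j - x i) ^+ 2).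
apply: (@mean_le_ub _ _ _ _ _ (\sum_i \sum_j c i j * mean_mx P M i j)).
  have -> : \sum_i \sum_j c i j * mean_mx P M i j
      = var phi x - kap * dirichlet phi (mean_mx P M) x.
    have <- : \sum_i phi 0 i * \sum_j mean_mx P M i j * (x j - m) ^+ 2 = var phi x.
      exact: stationary_sum.
    rewrite /dirichlet mulr_sumr -sumrB; apply: eq_bigr => i _.
    rewrite !mulr_sumr -sumrB; apply: eq_bigr => j _.
    by rewrite /c; ring.
  have := @var_le_dirichlet R n phi _ phi_gt0 phi1 M_ge0 M1 phiM d0 k x d0_gt0
    (fun i j => dle (i, j)).
  set D := dirichlet _ _ _ => h.
  have h2 : b0 * var phi x <= kap * D.
    rewrite /b0 -mulrA ler_pM2l// mulrC.
    rewrite -ler_pdivlMr ?divr_gt0 ?exprn_gt0//.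
    by rewrite invf_div mulrC.
  have h3 : Num.min b0 2^-1 * var phi x <= b0 * var phi x.
    by rewrite ler_wpM2r ?var_ge0// ge_min lexx.
  lra.
apply: (@mean_le_ae _ _ _ _ _ (fun w => \sum_i \sum_j c i j * M w i j)).
  move: Mst Mdiag; apply: filterS2 => w [Mw_ge0 /mulmx_onesP Mw1] Mw_diag.
  apply: ler_sum => i _.
  have -> : \sum_j c i j * M w i j = phi 0 i *
      (\sum_j M w i j * (x j - m) ^+ 2
        - kap * \sum_j M w i j * ((x j - m) - (x i - m)) ^+ 2).
    rewrite mulr_sumr -sumrB mulr_sumr; apply: eq_bigr => j _.
    by rewrite /c; ring.
  rewrite ler_wpM2l ?(ltW (phi_gt0 _))//.
  have -> : \sum_j M w i j * x j - m = \sum_j M w i j * (x j - m).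
    under [RHS]eq_bigr do rewrite mulrBr.
    by rewrite sumrB -mulr_suml Mw1 mul1r.
  exact: weighted_mean_sq.
apply: mean_le_sum => i; apply: mean_le_sum => j.
rewrite mean_mxE -RintegralZl//; apply: mean_le_int; exact: int_funZ.
Qed.

(** With [H k] the [k]-fold averaged form of the identity, [qf (H k) Z] is the
    mean of the squared norm of [Z] after [k] independent mixing steps.  The sum
    of [H k] for [k <= K] telescopes under one more step: it loses [nsq Z] and
    gains [qf (H K.+1) Z], which is at most [nsq Z / 2] once [K] is large. *)
Lemma gossip_lyapunov n (B : T -> 'M[R]_n) (psi : 'rV[R]_n) (kappa : R) :
  ess_bounded_mx B -> {ae P, forall w, row_stochastic (B w)^T} ->
  primitive_mx (mean_mx P (fun w => (B w)^T)) -> 0 < kappa ->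
  {ae P, forall w, forall i, kappa <= B w i i} ->
  (forall i, 0 < psi 0 i) -> \sum_i psi 0 i = 1 ->
  psi *m mean_mx P (fun w => (B w)^T) = psi ->
  exists (Q : 'M[R]_n), exists2 e : R, 0 < e <= 2^-1 &
   forall q (Z : 'M[R]_(n, q)), nsq Z <= qf Q Z /\
    ((const_mx 1 : 'rV[R]_n) *m Z = 0 ->
      mean_le P (fun w => qf Q (B w *m Z)) ((1 - e) * qf Q Z)).
Proof.
move=> hB Bst Bprim k_gt0 Bdiag psi_gt0 psi1 psiB.
have hBt := ess_bounded_mx_tr hB.
have [|b /andP[b_gt0 b_le] bP] := var_contraction hBt Bst Bprim k_gt0 _ psi_gt0 psi1 psiB.
  by move: Bdiag; apply: filterS => w h i; rewrite mxE.
have [d0 d0_gt0 dle] := pos_family_lower_bound psi_gt0.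
(* The transposes of [B] are row-stochastic, so they contract the variance. *)
have var_step (x : 'cV[R]_n) : qf (gram_step B (var_mx psi)) x <= (1 - b) * qf (var_mx psi) x.
  have [i1 <-] := qf_gram_step (var_mx psi) x hB.
  exact: (mean_le_Rint i1 (bP _ _)).
have b1_ge0 : 0 <= 1 - b by rewrite subr_ge0 (le_trans b_le)// invf_le1 ?ler1n.
have decay q (Z : 'M[R]_(n, q)) : (const_mx 1 : 'rV[R]_n) *m Z = 0 -> forall k (x : 'cV[R]_n),
    qf (iter k (gram_step B) (Z *m Z^T)) x <= nsq Z / d0 * (1 - b) ^+ k * qf (var_mx psi) x.
  move=> Z0; elim=> [|k IH] x; first by rewrite expr0 mulr1; exact: qf_gram_le.
  rewrite iterS -(qf_gram_step _ x hB).2.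
  have [i1 _] := qf_gram_step (iter k (gram_step B) (Z *m Z^T)) x hB.
  have [i2 h2] := qf_gram_step (var_mx psi) x hB.
  apply: (@le_trans _ _ (\int[P]_w (nsq Z / d0 * (1 - b) ^+ k * qf (var_mx psi) ((B w)^T *m x)))).
    apply: le_ae_Rint => //; first exact: int_funZ.
    exact: aeW.
  rewrite RintegralZl// h2 exprSr (mulrA _ _ (1 - b)) -(mulrA _ (1 - b)) ler_wpM2l//.
  by rewrite mulr_ge0 ?exprn_ge0// divr_ge0 ?nsq_ge0 ?ltW.
pose t := 1 + \tr (var_mx psi).
have t_gt0 : 0 < t.
  rewrite ltr_pwDl// trace_qf; apply: sumr_ge0 => i _; exact: qf_var_mx_ge0.
have [K hK] : exists K, (1 - b) ^+ K <= d0 / t / 2.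
  by apply: expr_small => //; rewrite ?gtrBl// !divr_gt0.
pose H k := iter k (form_step B) 1%:M.
(* Duality moves the iterates from forms to Gram matrices, where [decay] acts. *)
have half q (Z : 'M[R]_(n, q)) : (const_mx 1 : 'rV[R]_n) *m Z = 0 ->
    qf (H K.+1) Z <= nsq Z / 2.
  move=> Z0; rewrite /qf form_gram_dual_iter// mul1mx trace_qf.
  apply: (@le_trans _ _ (nsq Z / d0 * (1 - b) ^+ K.+1 * \tr (var_mx psi))).
    by rewrite [X in _ * X]trace_qf mulr_sumr; apply: ler_sum => i _; exact: decay.
  apply: (@le_trans _ _ (nsq Z / d0 * (d0 / t / 2) * t)).
    have nz : 0 <= nsq Z / d0 by rewrite divr_ge0 ?nsq_ge0 ?ltW.
    have tr0 : 0 <= \tr (var_mx psi).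
      by rewrite trace_qf; apply: sumr_ge0 => i _; exact: qf_var_mx_ge0.
    apply: ler_pM => //; [exact: mulr_ge0 nz (exprn_ge0 _ b1_ge0)| |by rewrite lerDr].
    rewrite ler_wpM2l// (le_trans _ hK)// exprS ler_piMl ?exprn_ge0//.
    by rewrite gerBl ltW.
  rewrite le_eqVlt; apply/orP; left; apply/eqP; field.
  by rewrite !gt_eqF.
have H_ge0 q k (Z : 'M[R]_(n, q)) : 0 <= qf (H k) Z.
  elim: k Z => [|k IH] Z; first by rewrite qf1 nsq_ge0.
  by rewrite /H iterS -(mean_qf _ Z hB).2; apply: Rintegral_ge0 => w _.
pose Q := \sum_(k < K.+1) H k.
have Q_ge q (Z : 'M[R]_(n, q)) : nsq Z <= qf Q Z.
  rewrite /Q qf_sum big_ord_recl qf1 lerDl; apply: sumr_ge0 => k _; exact: H_ge0.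
pose e := (1 + nsq Q)^-1 / 2.
have C_gt0 : 0 < 1 + nsq Q by rewrite ltr_pwDl// nsq_ge0.
exists Q, e.
  rewrite /e divr_gt0 ?invr_gt0//= ler_piMl ?invr_ge0//.
  by rewrite invf_le1// lerDl nsq_ge0.
move=> q Z; split=> // Z0.
have [iQ eQ] := mean_qf Q Z hB.
apply: mean_le_ub (mean_le_int iQ); rewrite eQ.
have -> : qf (form_step B Q) Z = qf Q Z - nsq Z + qf (H K.+1) Z.
  rewrite -eQ.
  have -> : (fun w => qf Q (B w *m Z)) = fun w => \sum_(k < K.+1) qf (H k) (B w *m Z).
    by apply/funext => w; rewrite /Q qf_sum.
  rewrite (Rint_sum (fun k : 'I_K.+1 => (mean_qf (H k) Z hB).1)).2.
  rewrite (eq_bigr (fun k : 'I_K.+1 => qf (H k.+1) Z)); last first.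
    by move=> k _; rewrite (mean_qf _ Z hB).2 /H iterS.
  rewrite [LHS]big_ord_recr /= /Q qf_sum [in RHS]big_ord_recl /= {2}/H /= qf1.
  by rewrite [X in X - _]addrC addrK.
have h1 := half q Z Z0; have h2 := qf_le_nsq Q Z.
have h3 : e * qf Q Z <= nsq Z / 2.
  by rewrite /e mulrAC ler_wpM2r ?invr_ge0// mulrC ler_pdivrMr// mulrC.
lra.
Qed.

End RandomMatrix.

(** * Gradients of a strongly convex average *)

Section Gradient.
Variable R : realType.

Lemma enorm_sqr p (x : 'rV[R]_p) : enorm x ^+ 2 = nsq x.
Proof.
rewrite /enorm sqr_sqrtr; last by apply: sumr_ge0 => j _; rewrite sqr_ge0.
by rewrite /nsq big_ord1.
Qed.

Lemma smooth_sqr p (L : R) (g : 'rV[R]_p -> R) x y : smooth L g ->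
  nsq (gradient g x - gradient g y) <= L ^+ 2 * nsq (x - y).
Proof.
move=> [_ /(_ x y) h]; rewrite -!enorm_sqr -exprMn lerXn2r ?nnegrE//.
  exact: sqrtr_ge0.
by apply: le_trans h; exact: sqrtr_ge0.
Qed.

Lemma derive_gradient p (g : 'rV[R]_p -> R) x v : differentiable g x ->
  'D_v g x = dotmx (gradient g x) v.
Proof.
move=> dg; rewrite deriveE// {1}[v]row_sum_delta linear_sum /= /dotmx big_ord1.
by apply: eq_bigr => j _; rewrite linearZ /= mxE deriveE// mulrC.
Qed.

Variables (n p : nat) (f : 'I_n -> 'rV[R]_p -> R) (L mu : R) (xs : 'rV[R]_p).
Hypothesis f_smooth : forall i, smooth L (f i).

Lemma gradF_lipschitz X Y : nsq (gradF f X - gradF f Y) <= L ^+ 2 * nsq (X - Y).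
Proof.
rewrite nsq_rows [in leRHS]nsq_rows mulr_sumr; apply: ler_sum => i _.
by rewrite !linearB /= !rowK; exact: smooth_sqr.
Qed.

(** Written as a matrix product so that Lipschitz bounds on [gradF] apply to it. *)
Definition sum_grad (x : 'rV[R]_p) : 'rV[R]_p :=
  (const_mx 1 : 'rV[R]_n) *m gradF f ((const_mx 1 : 'cV[R]_n) *m x).

Lemma row_const_mul (x : 'rV[R]_p) i : row i ((const_mx 1 : 'cV[R]_n) *m x) = x.
Proof. by rewrite row_mul row_const; apply/rowP => j; rewrite mxE big_ord1 mxE mul1r. Qed.

Lemma sum_gradE x : sum_grad x = \sum_i gradient (f i) x.
Proof.
rewrite /sum_grad; apply/rowP => j; rewrite mxE summxE; apply: eq_bigr => i _.
rewrite mxE mul1r.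
have -> : gradF f (const_mx 1 *m x) i j = row i (gradF f (const_mx 1 *m x)) 0 j.
  by rewrite [RHS]mxE.
by rewrite rowK row_const_mul.
Qed.

Hypothesis mu_gt0 : 0 < mu.
Hypothesis f_sc : strongly_convex mu (average f).
Hypothesis xs_min : minimizer (average f) xs.
Hypothesis n_gt0 : (0 < n)%N.

(** Strong convexity on the segment from [x] to the minimizer bounds the difference
    quotient of the average by [- (mu / 2) (1 - h) |x - xs|^2]; restricting to
    [h < 1 / 2] gives the constant [mu / 4]. *)
Lemma strong_monotone x :
  n%:R * (mu / 4) * nsq (x - xs) <= dotmx (sum_grad x) (x - xs).
Proof.
pose v := xs - x.
pose q i (h : R) := h^-1 *: ((f i \o shift x) (h *: v) - f i x).
have cvq i : q i h @[h --> 0^'+] --> dotmx (gradient (f i) x) v.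
  apply: cvg_dnbhs_at_right; rewrite -derive_gradient; last exact: (f_smooth i).1.
  by apply: diff_derivable; exact: (f_smooth i).1.
have cvs : (\sum_i q i h) @[h --> 0^'+] --> \sum_i dotmx (gradient (f i) x) v.
  by apply: cvg_big => [|i _]; [exact: add_continuous|exact: cvq].
have dotE : \sum_i dotmx (gradient (f i) x) v = - dotmx (sum_grad x) (x - xs).
  rewrite sum_gradE [in RHS]dotmxC -dotmxNl opprB dotmxC -/v.
  rewrite /dotmx big_ord1; under eq_bigr => i _ do rewrite big_ord1.
  rewrite exchange_big; apply: eq_bigr => j _.
  by rewrite summxE mulr_suml.
have n0 : (0 : R) < n%:R by rewrite ltr0n.
suff : \sum_i dotmx (gradient (f i) x) v <= - (n%:R * (mu / 4) * nsq (x - xs)).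
  by rewrite dotE lerN2.
apply: (cvgr_to_le cvs); near=> h.
have h_gt0 : 0 < h by near: h; exact: nbhs_right_gt.
have h_lt : h < 2^-1 by near: h; apply: nbhs_right_lt; rewrite invr_gt0 ltr0n.
have -> : \sum_i q i h = n%:R * (h^-1 * (average f (h *: v + x) - average f x)).
  rewrite /average -mulrBr -sumrB mulrCA mulVKf ?gt_eqF// mulr_sumr.
  by apply: eq_bigr.
rewrite -(mulrA n%:R) -(mulrN n%:R) ler_pM2l// [leLHS]mulrC ler_pdivrMr//.
have h_lt1 : h < 1 by apply: lt_trans h_lt _; rewrite invf_lt1 ?ltr1n ?ltr0n.
have := f_sc xs x (ltW h_gt0) (ltW h_lt1).
have -> : h *: xs + (1 - h) *: x = h *: v + x.
  by rewrite /v scalerBl scale1r scalerBr addrA addrAC.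
have -> : enorm (xs - x) ^+ 2 = nsq (x - xs) by rewrite enorm_sqr -nsqN opprB.
have := xs_min x; have := nsq_ge0 (x - xs).
set N := nsq _; set a := average f x; set b := average f xs => N_ge0 ba le1.
have e1 : 0 <= h * (a - b) by rewrite mulr_ge0 ?subr_ge0// ltW.
have e2 : 0 <= h * mu * N * (2^-1 - h).
  by rewrite mulr_ge0 ?subr_ge0 ?(ltW h_lt)// !mulr_ge0// ltW.
nra.
Unshelve. all: by end_near.
Qed.

(** Let [G] be the value at the minimizer.  At the point [xs - t *: G] monotonicity
    makes the gradient sum point away from [G], whereas for small [t] it is still
    close to [G] by Lipschitz continuity; so [G] vanishes. *)
Lemma sum_grad_minimizer : sum_grad xs = 0.
Proof.
set G := sum_grad xs.
pose M : R := n%:R * (L ^+ 2 * n%:R).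
have M_ge0 : 0 <= M by apply: mulr_ge0 => //; apply: mulr_ge0 => //; exact: sqr_ge0.
have lip x : nsq (sum_grad x - G) <= M * nsq (x - xs).
  rewrite /G /sum_grad -mulmxBr; apply: le_trans (nsqM _ _) _.
  have n1 : nsq (const_mx 1 : 'rV[R]_n) <= n%:R.
    by rewrite -[leRHS]mul1r; apply: nsq_unit_entries => i j; rewrite mxE ler01 lexx.
  have n2 : nsq (const_mx 1 : 'cV[R]_n) <= n%:R.
    by rewrite -[leRHS]mulr1; apply: nsq_unit_entries => i j; rewrite mxE ler01 lexx.
  have -> : M * nsq (x - xs) = n%:R * (L ^+ 2 * (n%:R * nsq (x - xs))).
    by rewrite /M; ring.
  rewrite ler_pM ?nsq_ge0//.
  apply: le_trans (gradF_lipschitz _ _) _; rewrite -mulmxBr ler_wpM2l ?sqr_ge0//.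
  by apply: le_trans (nsqM _ _) _; rewrite ler_wpM2r// nsq_ge0.
(* Small enough for [M * t ^+ 2 < 1], hence for the gradient sum at [x] to differ
   from [G] by less than [G] itself. *)
pose t := (1 + M)^-1.
have t_gt0 : 0 < t by rewrite invr_gt0 ltr_pwDl.
have Mt : M * t ^+ 2 < 1.
  rewrite exprVn ltr_pdivrMr ?exprn_gt0 ?ltr_pwDl// mul1r; nra.
pose x := xs - t *: G.
have xE : x - xs = (- t) *: G by rewrite /x addrC addKr scaleNr.
have := strong_monotone x; have := lip x.
rewrite xE dotmxZr nsqZ sqrrN => lipx mono.
have h1 : dotmx (sum_grad x) G <= 0.
  have : 0 <= - t * dotmx (sum_grad x) G.
    apply: le_trans mono; rewrite !mulr_ge0 ?nsq_ge0 ?sqr_ge0 ?ler0n ?ltW//.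
  by rewrite mulNr oppr_ge0 pmulr_rle0.
have h2 := dotmx_young (- (sum_grad x - G)) G (@ltr01 R).
move: h2; rewrite invr1 !mul1r nsqN opprB dotmxDl dotmxNl dotmx_self => h2.
have G0 := nsq_ge0 G.
have : nsq G <= 0.
  have : (1 - M * t ^+ 2) * nsq G <= 0 by lra.
  by rewrite pmulr_rle0// subr_gt0.
move=> Gle; apply/rowP => j; rewrite [RHS]mxE.
apply/eqP; rewrite -sqrf_eq0 eq_le sqr_ge0 andbT.
exact: le_trans (sqr_le_nsq _ _ _) Gle.
Qed.

End Gradient.

(** * Domination up to a constant *)

Section Dominated.
Variables (R : realFieldType) (S : Type) (good : S -> Prop).
Implicit Types g h k : S -> R.

(** Hides the constants of the estimates, which depend neither on the state nor on
    the step-size. *)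
Definition dominated g h := exists2 K : R, 0 <= K & forall s, good s -> g s <= K * h s.

Lemma dominated_le g g' h : (forall s, good s -> g s <= g' s) ->
  dominated g' h -> dominated g h.
Proof. by move=> gg' [K K0 hK]; exists K => // s hs; exact: le_trans (gg' s hs) (hK s hs). Qed.

Lemma dominated_trans g h k : dominated g h -> dominated h k -> dominated g k.
Proof.
move=> [K K0 hK] [K' K'0 hK']; exists (K * K'); first exact: mulr_ge0.
by move=> s hs; rewrite -mulrA (le_trans (hK s hs))// ler_wpM2l// hK'.
Qed.

Lemma dominatedD g g' h : dominated g h -> dominated g' h ->
  dominated (fun s => g s + g' s) h.
Proof.
move=> [K K0 hK] [K' K'0 hK']; exists (K + K'); first exact: addr_ge0.
by move=> s hs; rewrite mulrDl lerD ?hK ?hK'.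
Qed.

Lemma dominatedZ (c : R) g h : 0 <= c -> dominated g h -> dominated (fun s => c * g s) h.
Proof.
move=> c0 [K K0 hK]; exists (c * K); first exact: mulr_ge0.
by move=> s hs; rewrite -mulrA ler_wpM2l ?hK.
Qed.

Lemma dominated_nsqM (c : R) q r t
    (M : S -> 'M[R]_(q, r)) (N : S -> 'M[R]_(r, t)) h :
  (forall s, good s -> nsq (M s) <= c) -> dominated (fun s => nsq (N s)) h ->
  dominated (fun s => nsq (M s *m N s)) h.
Proof.
move=> Mc [K K0 hK]; exists (`|c| * K); first exact: mulr_ge0.
move=> s hs; apply: le_trans (nsqM _ _) _; rewrite -mulrA ler_pM ?nsq_ge0 ?hK//.
exact: le_trans (Mc _ hs) (ler_norm c).
Qed.

Lemma dominated_nsqD q r (M N : S -> 'M[R]_(q, r)) h :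
  dominated (fun s => nsq (M s)) h -> dominated (fun s => nsq (N s)) h ->
  dominated (fun s => nsq (M s + N s)) h.
Proof.
move=> hM hN; apply: dominated_le (fun s _ => nsqD_le (M s) (N s)) _.
by apply: dominatedD; apply: dominatedZ.
Qed.

Lemma dominated_nsqN q r (M : S -> 'M[R]_(q, r)) h :
  dominated (fun s => nsq (M s)) h -> dominated (fun s => nsq (- M s)) h.
Proof. by apply: dominated_le => s _; rewrite nsqN. Qed.

End Dominated.

(** The arguments [a], [b], [c], [d] stand for the optimality error, the
    disagreement, the staleness and the tracking error.  First [wc], then [wb] is
    chosen so that the decrease of its own term exceeds by 1 all that this term
    feeds, with coefficients of order one, into the terms of smaller weight; the
    contributions of order [eta] and [eta ^+ 2] then fit into these margins, into
    [de] and into [eta * theta / 2]. *)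
Lemma weighted_contraction (R : realFieldType) (K theta be ga de : R) :
  0 <= K -> 0 < theta -> 0 < be -> 0 < ga -> 0 < de ->
  exists wb wc eta0 : R, [/\ 0 < wb, 0 < wc, 0 < eta0 &
    forall eta, 0 < eta -> eta <= eta0 -> exists2 rho : R, 0 < rho < 1 &
    forall a b c d, 0 <= a -> 0 <= b -> 0 <= c -> 0 <= d ->
      ((1 - eta * theta) * a + eta * (K * (b + c + d)) + K * b
         + eta ^+ 2 * (K * (a + b + c + d)))
      + (wb * ((1 - be) * b + eta ^+ 2 * (K * (a + b + c + d)))
      + (wc * ((1 - ga) * c + K * b + eta ^+ 2 * (K * (a + b + c + d)))
      + ((1 - de) * d + K * c)))
      <= rho * (a + (wb * b + (wc * c + d)))].
Proof.
move=> K0 th0 be0 ga0 de0.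
pose wc := (K + 1) / ga; pose wb := (K + wc * K + 1) / be.
have wc0 : 0 < wc by rewrite divr_gt0// ltr_wpDl.
have wb0 : 0 < wb by rewrite divr_gt0// ltr_wpDl// addr_ge0// mulr_ge0// ltW.
pose W := 1 + wb + wc; pose M := K + K * W + theta * W + 1.
have W0 : 0 < W by rewrite !addr_gt0.
have KW0 : 0 <= K * W by rewrite mulr_ge0// ltW.
have thW0 : 0 < theta * W by rewrite mulr_gt0.
have M0 : 0 < M by rewrite /M; lra.
exists wb, wc, (Num.min 1 (Num.min (1 / M) (Num.min (de / M) (theta / 2 / M)))).
split => //; first by rewrite !lt_min ltr01 !divr_gt0.
move=> eta eta_gt0; rewrite !le_min => /and4P[eta1].
rewrite !(ler_pdivlMr _ _ M0) => h1 h2 h3.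
have ebe : wb * be = K + wc * K + 1 by rewrite /wb divfK// gt_eqF.
have ega : wc * ga = K + 1 by rewrite /wc divfK// gt_eqF.
have eM : eta * M = eta * K + eta * (K * W) + eta * theta * W + eta by rewrite /M; ring.
have eW : eta * theta * W = eta * theta + eta * theta * wb + eta * theta * wc.
  by rewrite /W; ring.
have p1 : 0 < eta * theta by rewrite mulr_gt0.
have p2 : 0 < eta * theta * wb by rewrite mulr_gt0.
have p3 : 0 < eta * theta * wc by rewrite mulr_gt0.
have p4 : 0 <= eta * K by rewrite mulr_ge0// ltW.
have p5 : 0 <= eta * (K * W) by rewrite mulr_ge0// ltW.
have p6 : eta ^+ 2 * (K * W) <= eta * (K * W).
  by rewrite ler_wpM2r// expr2 ler_piMl// ltW.
have p7 : eta ^+ 2 * (K * W) <= eta * (theta / 2).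
  rewrite expr2 -(mulrA eta eta) ler_pM2l//; apply: le_trans h3; rewrite eM.
  lra.
exists (1 - eta * theta / 2); first by lra.
move=> a b c d a0 b0 c0 d0; rewrite -subr_ge0.
set E2K := eta ^+ 2 * (K * W) in p6 p7.
have eE : E2K = eta ^+ 2 * K * (1 + wb + wc) by rewrite /E2K /W; ring.
rewrite [X in 0 <= X](_ : _ =
    a * (eta * theta / 2 - E2K) +
    (b * (wb * be - eta * K - K - E2K - wc * K - eta * theta * wb / 2) +
    (c * (wc * ga - eta * K - K - E2K - eta * theta * wc / 2) +
     d * (de - eta * K - E2K - eta * theta / 2)))); last by rewrite eE; field.
clear eE; clearbody E2K.
rewrite !addr_ge0// mulr_ge0//; lra.
Qed.

Lemma active_mx_idem (R : realType) n (V : {set 'I_n}) :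
  active_mx R V *m active_mx R V = active_mx R V.
Proof.
rewrite /active_mx mulmx_diag; congr diag_mx; apply/rowP => i.
by rewrite !mxE -natrM mulnb andbb.
Qed.

Lemma active_mx_entry (R : realType) n (V : {set 'I_n}) i j :
  0 <= active_mx R V i j <= 1.
Proof. by rewrite !mxE; case: (i \in V); case: (i == j); rewrite ?lexx ?ler01. Qed.

(** * One iteration in the mean *)

Section ExtendedState.
Variables (R : realType) (n p : nat) (gF : 'M[R]_(n, p) -> 'M[R]_(n, p)).

Local Notation u := (const_mx 1 : 'rV[R]_n).

(** The states (X, Y, C) of the algorithm, with push-sum weights as last component. *)
Definition ext_state := (('M[R]_(n, p) * 'M[R]_(n, p) * 'M[R]_(n, p)) * 'cV[R]_n)%type.

(** The weights form a probability vector and the trackers add up to the gradients at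
    the stored points. *)
Definition is_balanced (s : ext_state) :=
  [/\ forall i, 0 <= s.2 i 0, u *m s.2 = const_mx 1 & u *m s.1.1.2 = u *m gF s.1.2].

Definition ext_step (eta : R) (V : {set 'I_n}) (A B : 'M[R]_n) (s : ext_state) : ext_state :=
  let D := active_mx R V in
  let Yhalf := s.1.1.2 + D *m (gF s.1.1.1 - gF s.1.2) in
  ((A *m (s.1.1.1 - eta *: (D *m Yhalf)), B *m Yhalf,
    D *m s.1.1.1 + (1%:M - D) *m s.1.2), B *m s.2).

(** Both sums are kept because [B] is column-stochastic; the stored gradients change by
    exactly the amount added to the trackers. *)
Lemma is_balanced_step eta V A B s :
  (forall X C, gF (active_mx R V *m X + (1%:M - active_mx R V) *m C) =
     active_mx R V *m gF X + (1%:M - active_mx R V) *m gF C) ->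
  column_stochastic B -> is_balanced s -> is_balanced (ext_step eta V A B s).
Proof.
move=> gF_local [B_ge0 uB] [w_ge0 w1 uY]; split => /=.
- by move=> i; rewrite mxE; apply: sumr_ge0 => j _; rewrite mulr_ge0.
- by rewrite mulmxA uB.
- rewrite mulmxA uB mulmxDr uY -mulmxDr gF_local; congr (_ *m _).
  rewrite mulmxBr mulmxBl mul1mx.
  move: (_ *m gF s.1.1.1) (_ *m gF s.1.2) => x y.
  by apply/matrixP => i j; rewrite !mxE; ring.
Qed.

End ExtendedState.

Section OneStep.
Context d (T : measurableType d) (R : realType) (P : probability T R) (n p : nat).
Variables (gF : 'M[R]_(n, p) -> 'M[R]_(n, p)) (l2 m : R) (xs : 'rV[R]_p).
Variables (V : T -> {set 'I_n}) (A B : T -> 'M[R]_n) (kappa : R).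
Variables (phi : 'rV[R]_n) (b0 : R) (Q : 'M[R]_n) (e0 : R).

Local Notation u := (const_mx 1 : 'rV[R]_n).
Local Notation o := (const_mx 1 : 'cV[R]_n).
Local Notation D w := (active_mx R (V w)).
Local Notation state := (ext_state R n p).
Local Notation balanced := (is_balanced gF).

Hypothesis l2_ge0 : 0 <= l2.
Hypothesis m_gt0 : 0 < m.
Hypothesis gF_lip : forall X Y, nsq (gF X - gF Y) <= l2 * nsq (X - Y).
Hypothesis gF_mono : forall x : 'rV[R]_p, m * nsq (x - xs) <= dotmx (u *m gF (o *m x)) (x - xs).
Hypothesis gF_zero : u *m gF (o *m xs) = 0.

Hypothesis hA : ess_bounded_mx P A.
Hypothesis hD : ess_bounded_mx P (fun w => D w).
Hypothesis A_st : {ae P, forall w, row_stochastic (A w)}.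
Hypothesis B_st : {ae P, forall w, column_stochastic (B w)}.
Hypothesis kappa_gt0 : 0 < kappa.
Hypothesis A_diag : {ae P, forall w, forall i, kappa <= A w i i}.
Hypothesis D_mean : forall i, 0 < \int[P]_w D w i i.

Hypothesis phi_gt0 : forall i, 0 < phi 0 i.
Hypothesis phi1 : \sum_i phi 0 i = 1.
Hypothesis phiA : phi *m mean_mx P A = phi.
Hypothesis b0_bnd : 0 < b0 <= 2^-1.
Hypothesis A_contr : forall q (X : 'M[R]_(n, q)),
  mean_le P (fun w => qf (var_mx phi) (A w *m X)) ((1 - b0) * qf (var_mx phi) X).
Hypothesis e0_bnd : 0 < e0 <= 2^-1.
Hypothesis Q_contr : forall q (Z : 'M[R]_(n, q)), nsq Z <= qf Q Z /\
  (u *m Z = 0 -> mean_le P (fun w => qf Q (B w *m Z)) ((1 - e0) * qf Q Z)).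

Definition opt_err (s : state) : R := nsq (phi *m s.1.1.1 - xs).
Definition disagreement (s : state) : R := qf (var_mx phi) s.1.1.1.
Definition staleness (s : state) : R := nsq (s.1.1.1 - s.1.2).
Definition residual (s : state) := s.1.1.2 - s.2 *m (u *m s.1.1.2).
Definition track_err (s : state) : R := qf Q (residual s).

Definition fast_err s := disagreement s + staleness s + track_err s.
Definition total_err s := opt_err s + disagreement s + staleness s + track_err s.

Definition centered (s : state) := s.1.1.1 - o *m (phi *m s.1.1.1).
Definition increment (s : state) := gF s.1.1.1 - gF s.1.2.
Definition direction (s : state) := s.1.1.2 + increment s.

Lemma opt_err_ge0 s : 0 <= opt_err s. Proof. exact: nsq_ge0. Qed.
Lemma disagreement_ge0 s : 0 <= disagreement s. Proof. exact: qf_var_mx_ge0. Qed.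
Lemma staleness_ge0 s : 0 <= staleness s. Proof. exact: nsq_ge0. Qed.
Lemma track_err_ge0 s : 0 <= track_err s.
Proof. exact: le_trans (nsq_ge0 _) (Q_contr _).1. Qed.

Local Notation dom := (dominated balanced).

Let err_ge0 s := (opt_err_ge0 s, disagreement_ge0 s, staleness_ge0 s, track_err_ge0 s).

Lemma fast_err_total : dom fast_err total_err.
Proof.
exists 1 => // s _; rewrite mul1r /fast_err /total_err.
have [[[? ?] ?] ?] := err_ge0 s; lra.
Qed.

Lemma disagreement_fast : dom disagreement fast_err.
Proof. by exists 1 => // s _; rewrite mul1r /fast_err; have [[[? ?] ?] ?] := err_ge0 s; lra. Qed.
Lemma staleness_fast : dom staleness fast_err.
Proof. by exists 1 => // s _; rewrite mul1r /fast_err; have [[[? ?] ?] ?] := err_ge0 s; lra. Qed.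
Lemma track_err_fast : dom track_err fast_err.
Proof. by exists 1 => // s _; rewrite mul1r /fast_err; have [[[? ?] ?] ?] := err_ge0 s; lra. Qed.
Lemma opt_err_total : dom opt_err total_err.
Proof. by exists 1 => // s _; rewrite mul1r /total_err; have [[[? ?] ?] ?] := err_ge0 s; lra. Qed.

Lemma centered_disagreement : dom (fun s => nsq (centered s)) disagreement.
Proof.
have [d0 d0_gt0 dle] := pos_family_lower_bound phi_gt0.
exists d0^-1; first by rewrite invr_ge0 ltW.
by move=> s _; exact: nsq_centered_le.
Qed.

Lemma increment_staleness : dom (fun s => nsq (increment s)) staleness.
Proof. by exists l2 => // s _; exact: gF_lip. Qed.

Lemma residual_track_err : dom (fun s => nsq (residual s)) track_err.
Proof. by exists 1 => // s _; rewrite mul1r; exact: (Q_contr _).1. Qed.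

Lemma weights_bounded s : balanced s -> nsq s.2 <= n%:R.
Proof.
move=> [w_ge0 w1 _]; rewrite -[leRHS]mulr1; apply: nsq_unit_entries => i j.
rewrite (ord1 j) w_ge0/=.
have /matrixP/(_ 0 0) := w1; rewrite !mxE => <-.
rewrite (bigD1 i)//= !mxE mul1r lerDl; apply: sumr_ge0 => k _.
by rewrite mxE mul1r.
Qed.

Lemma stored_vs_mean :
  dom (fun s => nsq (u *m (gF s.1.2 - gF (o *m (phi *m s.1.1.1))))) fast_err.
Proof.
apply: (dominated_nsqM (c := nsq u)) => //.
apply: (dominated_le (g' := fun s => l2 * nsq (centered s + - (s.1.1.1 - s.1.2)))).
  move=> s _; apply: le_trans (gF_lip _ _) _.
  have -> // : s.1.2 - o *m (phi *m s.1.1.1) = centered s + - (s.1.1.1 - s.1.2).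
  by rewrite /centered opprB [RHS]addrC addrA subrK.
apply: dominatedZ => //; apply: dominated_nsqD.
  exact: dominated_trans centered_disagreement disagreement_fast.
exact/dominated_nsqN/staleness_fast.
Qed.

(** All gradients are compared with those at the minimizer, which add up to 0. *)
Lemma direction_total : dom (fun s => nsq (direction s)) total_err.
Proof.
have toT h : dom h fast_err -> dom h total_err.
  by move=> hh; exact: dominated_trans hh fast_err_total.
apply: dominated_nsqD; last exact/toT/(dominated_trans increment_staleness staleness_fast).
apply: (dominated_le (g' := fun s => nsq (residual s + s.2 *m (u *m s.1.1.2)))).
  by move=> s _; rewrite /residual subrK.
apply: dominated_nsqD; first exact/toT/(dominated_trans residual_track_err track_err_fast).
apply: dominated_nsqM weights_bounded _.
apply: (dominated_le (g' := fun s =>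
    nsq (u *m (gF s.1.2 - gF (o *m (phi *m s.1.1.1)))
         + u *m (gF (o *m (phi *m s.1.1.1)) - gF (o *m xs))))).
  move=> s [_ _ ->]; rewrite -mulmxDr addrA subrK mulmxBr gF_zero subr0.
  by [].
apply: dominated_nsqD; first exact/toT/stored_vs_mean.
apply: (dominated_nsqM (c := nsq u)) => //.
apply: (dominated_le (g' := fun s => l2 * nsq (o *m (phi *m s.1.1.1 - xs)))).
  by move=> s _; rewrite mulmxBr; exact: gF_lip.
apply: dominatedZ => //; apply: (dominated_nsqM (c := nsq o)) => //.
exact: opt_err_total.
Qed.

Lemma ess_bounded_AD : ess_bounded_mx P (fun w => A w *m D w).
Proof. exact: ess_bounded_mxM. Qed.

(** The vector q of the introduction. *)
Definition step_weight : 'rV[R]_n := phi *m mean_mx P (fun w => A w *m D w).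

Lemma Rint_ge0_ae (g : T -> R) : ess_bounded P g -> {ae P, forall w, 0 <= g w} ->
  0 <= \int[P]_w g w.
Proof.
move=> hg g0; rewrite -(Rint_cst P 0); apply: le_ae_Rint => //.
- exact/ess_bounded_integrable/ess_bounded_cst.
- exact: ess_bounded_integrable.
Qed.

(** The diagonal term alone gives [phi 0 j * kappa * \int[P]_w D w j j]. *)
Lemma step_weight_lower : exists2 q0 : R, 0 < q0 & forall j, q0 <= step_weight 0 j.
Proof.
apply: pos_family_lower_bound => j.
rewrite mxE (bigD1 j)//= ltr_pwDl//; last first.
  apply: sumr_ge0 => i _; rewrite mulr_ge0 ?(ltW (phi_gt0 _))// mean_mxE.
  apply: Rint_ge0_ae; first exact: ess_bounded_AD.
  move: A_st; apply: filterS => w [Aw _]; rewrite mxE; apply: sumr_ge0 => k _.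
  by rewrite mulr_ge0// (andP (active_mx_entry _ _ _ _)).1.
rewrite mulr_gt0// mean_mxE.
apply: (@lt_le_trans _ _ (\int[P]_w (kappa * D w j j))).
  by rewrite RintegralZl ?mulr_gt0//; exact/ess_bounded_integrable.
apply: le_ae_Rint; [exact/int_funZ/ess_bounded_integrable|
  exact/ess_bounded_integrable/ess_bounded_AD|].
move: A_diag A_st; apply: filterS2 => w kA [Aw _]; rewrite [leRHS]mxE (bigD1 j)//= ler_wpDr//.
  apply: sumr_ge0 => k _; rewrite mulr_ge0//.
  by rewrite (andP (active_mx_entry _ _ _ _)).1.
by rewrite ler_wpM2r// (andP (active_mx_entry _ _ _ _)).1.
Qed.

(** Split [direction s] into [s.2] times the gradient sum at the mean point, which
    gives descent with a factor at least [q0], and errors which Young's inequality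
    trades against half of that descent. *)
Lemma descent_direction : exists2 theta : R, 0 < theta & exists2 K : R, 0 <= K &
  forall s, balanced s ->
    - 2 * dotmx (phi *m s.1.1.1 - xs) (step_weight *m direction s)
      <= - theta * opt_err s + K * fast_err s.
Proof.
have [q0 q0_gt0 q0_le] := step_weight_lower.
pose r (s : state) := u *m (gF s.1.2 - gF (o *m (phi *m s.1.1.1))).
pose E s := step_weight *m (s.2 *m r s + residual s + increment s).
have [K K0 hK] : dom (fun s => nsq (E s)) fast_err.
  apply: (dominated_nsqM (c := nsq step_weight)) => //.
  apply: dominated_nsqD; last exact: dominated_trans increment_staleness staleness_fast.
  apply: dominated_nsqD; last exact: dominated_trans residual_track_err track_err_fast.
  exact: dominated_nsqM weights_bounded stored_vs_mean.
pose theta := q0 * m; have th0 : 0 < theta by rewrite mulr_gt0.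
exists theta => //; exists (theta^-1 * K); first by rewrite mulr_ge0// invr_ge0 ltW.
move=> s hs; set v := phi *m s.1.1.1 - xs.
have [w_ge0 w1 uY] := hs.
pose tau := (step_weight *m s.2) 0 0.
have tau_ge : q0 <= tau.
  rewrite /tau mxE.
  have <- : \sum_j q0 * s.2 j 0 = q0.
    have /matrixP/(_ 0 0) := w1; rewrite !mxE => w1'.
    rewrite -mulr_sumr -[RHS]mulr1 -w1'; congr (_ * _).
    by apply: eq_bigr => j _; rewrite mxE mul1r.
  by apply: ler_sum => j _; rewrite ler_wpM2r.
have -> : step_weight *m direction s
    = tau *: (u *m gF (o *m (phi *m s.1.1.1))) + E s.
  have -> : direction s = s.2 *m (u *m gF (o *m (phi *m s.1.1.1)))
      + (s.2 *m r s + residual s + increment s).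
    rewrite /direction /residual uY.
    have -> : u *m gF s.1.2 = u *m gF (o *m (phi *m s.1.1.1)) + r s.
      by rewrite /r mulmxBr addrC subrK.
    rewrite mulmxDr; set x := s.2 *m (u *m _); set y := s.2 *m r s.
    by rewrite [RHS]addrA (addrA x); congr (_ + _); rewrite addrC subrK.
  rewrite mulmxDr; congr (_ + _).
  by rewrite mulmxA [step_weight *m s.2]mx11_scalar mul_scalar_mx.
rewrite dotmxDr dotmxZr.
have h1 : q0 * (m * opt_err s) <= tau * dotmx v (u *m gF (o *m (phi *m s.1.1.1))).
  apply: (@le_trans _ _ (tau * (m * opt_err s))).
    by rewrite ler_wpM2r// mulr_ge0 ?opt_err_ge0// ltW.
  rewrite ler_wpM2l ?(le_trans _ tau_ge) ?(ltW q0_gt0)// dotmxC; exact: gF_mono.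
have h2 := dotmx_young v (- E s) th0.
move: h2; rewrite nsqN dotmxC dotmxNl dotmxC => h2.
have h3 : theta^-1 * nsq (E s) <= theta^-1 * K * fast_err s.
  by rewrite -mulrA; apply: ler_wpM2l; [rewrite invr_ge0 ltW|exact: hK].
have ov : nsq v = opt_err s by [].
rewrite ov in h2; rewrite mulrA -/theta in h1; lra.
Qed.

Definition next_X (eta : R) w (s : state) : 'M[R]_(n, p) :=
  A w *m (s.1.1.1 - eta *: (D w *m (s.1.1.2 + D w *m increment s))).
Definition next_Y w (s : state) : 'M[R]_(n, p) := B w *m (s.1.1.2 + D w *m increment s).
Definition next_C w (s : state) : 'M[R]_(n, p) := D w *m s.1.1.1 + (1%:M - D w) *m s.1.2.
Definition next eta w (s : state) : state :=
  ((next_X eta w s, next_Y w s, next_C w s), B w *m s.2).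

(** Idempotence of the activity matrix removes the second occurrence of [D]. *)
Lemma next_XE eta w s :
  next_X eta w s = A w *m s.1.1.1 - eta *: (A w *m D w *m direction s).
Proof.
by rewrite /next_X mulmxBr -scalemxAr mulmxDr mulmxA active_mx_idem -mulmxDr mulmxA.
Qed.

Lemma phi_ones : phi *m o = (1%:M : 'M[R]_1).
Proof.
apply/matrixP => i j; rewrite (ord1 i) (ord1 j) !mxE eqxx -[RHS]phi1.
by apply: eq_bigr => k _; rewrite mxE mulr1.
Qed.

Lemma phi_centered s : phi *m centered s = 0.
Proof. by rewrite /centered mulmxBr (mulmxA phi o) phi_ones mul1mx subrr. Qed.

Lemma nsq_A : {ae P, forall w, nsq (A w) <= n%:R * n%:R}.
Proof.
move: A_st; apply: filterS => w [A0 A1]; apply: nsq_unit_entries => i j.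
by rewrite A0 (entry_le1 A0 A1).
Qed.

Lemma nsq_D w : nsq (D w) <= n%:R * n%:R.
Proof. by apply: nsq_unit_entries => i j; exact: active_mx_entry. Qed.

Lemma nsq_AD : {ae P, forall w, forall q (W : 'M[R]_(n, q)),
  nsq (A w *m D w *m W) <= (n%:R * n%:R) ^+ 2 * nsq W}.
Proof.
move: nsq_A; apply: filterS => w hw q W.
apply: le_trans (nsqM _ _) _; rewrite ler_wpM2r ?nsq_ge0//.
apply: le_trans (nsqM _ _) _; rewrite expr2 ler_pM ?nsq_ge0//; exact: nsq_D.
Qed.

Lemma mean_dot (k : R) (M : T -> 'M[R]_n) q (v : 'rV[R]_q) (W : 'M[R]_(n, q)) :
  ess_bounded_mx P M ->
  mean_le P (fun w => k * dotmx v (phi *m M w *m W))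
            (k * dotmx v (phi *m mean_mx P M *m W)).
Proof.
move=> hM.
have dotE (N : 'M[R]_n) : dotmx v (phi *m N *m W) = \tr (N *m (W *m v^T *m phi)).
  by rewrite dotmxC -trace_mul_tr -!mulmxA mxtrace_mulC !mulmxA.
under eq_fun do rewrite dotE.
rewrite dotE -(mean_trace _ hM).2 -RintegralZl//; last exact: (mean_trace _ hM).1.
by apply: mean_le_int; apply: int_funZ; exact: (mean_trace _ hM).1.
Qed.

(** The term of [next_X] due to the disagreement has mean zero after averaging with
    [phi], so it only contributes through its square. *)
Lemma mean_opt_err : exists2 theta : R, 0 < theta & exists2 K : R, 0 <= K &
  forall s, balanced s -> forall eta, 0 < eta ->
  mean_le P (fun w => opt_err (next eta w s))
    ((1 - eta * theta) * opt_err s + eta * (K * fast_err s) + K * disagreement s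
      + eta ^+ 2 * (K * total_err s)).
Proof.
have [theta th0 [K1 K1_ge0 hK1]] := descent_direction.
have [K2 K2_ge0 hK2] := centered_disagreement; have [K3 K3_ge0 hK3] := direction_total.
pose c1 := nsq phi * (n%:R * n%:R); pose c2 := nsq phi * (n%:R * n%:R) ^+ 2.
have nn_ge0 : 0 <= n%:R * n%:R :> R by exact: mulr_ge0.
have c1_ge0 : 0 <= c1 by apply: mulr_ge0 => //; exact: nsq_ge0.
have c2_ge0 : 0 <= c2 by apply: mulr_ge0; [exact: nsq_ge0|exact: exprn_ge0].
have K2' : 0 <= 2 * c1 * K2 by apply: mulr_ge0 => //; exact: mulr_ge0.
have K3' : 0 <= 2 * c2 * K3 by apply: mulr_ge0 => //; exact: mulr_ge0.
exists theta => //; exists (K1 + 2 * c1 * K2 + 2 * c2 * K3); first by lra.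
move=> s hs eta eta_gt0; set v := phi *m s.1.1.1 - xs.
apply: (@mean_le_ae _ _ _ _ _ (fun w =>
   (opt_err s + 2 * c1 * nsq (centered s) + eta ^+ 2 * (2 * c2 * nsq (direction s))) +
   (2 * dotmx v (phi *m A w *m centered s) +
    (- 2 * eta) * dotmx v (phi *m (A w *m D w) *m direction s)))).
  move: nsq_A nsq_AD A_st; apply: filterS3 => w hA1 hAD [_ Ao].
  have -> : opt_err (next eta w s) = nsq (v + (phi *m A w *m centered s
      - eta *: (phi *m (A w *m D w) *m direction s))).
    rewrite /opt_err /= next_XE mulmxBr -scalemxAr /centered.
    rewrite mulmxBr -(mulmxA phi (A w) (o *m _)) (mulmxA (A w) o) Ao (mulmxA phi o).
    rewrite phi_ones mul1mx -!mulmxA /v; congr nsq.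
    move: (phi *m (_ *m s.1.1.1)) (eta *: _) (phi *m s.1.1.1) => x y z.
    by apply/matrixP => i j; rewrite !mxE; ring.
  have dotB x y : dotmx v (x - eta *: y) = dotmx v x - eta * dotmx v y.
    by rewrite dotmxDr -scaleNr dotmxZr mulNr.
  rewrite nsqD dotB.
  have h := nsqB_le (phi *m A w *m centered s) (eta *: (phi *m (A w *m D w) *m direction s)).
  rewrite nsqZ in h.
  have h1 : nsq (phi *m A w *m centered s) <= c1 * nsq (centered s).
    apply: le_trans (nsqM _ _) _; rewrite ler_wpM2r ?nsq_ge0//.
    by apply: le_trans (nsqM _ _) _; rewrite ler_wpM2l ?nsq_ge0.
  have h2 : nsq (phi *m (A w *m D w) *m direction s) <= c2 * nsq (direction s).
    rewrite -(mulmxA phi); apply: le_trans (nsqM _ _) _.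
    by rewrite /c2 -(mulrA (nsq phi)) ler_wpM2l ?nsq_ge0.
  have h3 : eta ^+ 2 * nsq (phi *m (A w *m D w) *m direction s)
     <= eta ^+ 2 * (c2 * nsq (direction s)) by rewrite ler_wpM2l ?sqr_ge0.
  have -> : nsq v = opt_err s by [].
  lra.
apply: mean_le_ub; last first.
  apply: mean_leD; first exact: mean_le_cst.
  apply: mean_leD; [exact: mean_dot hA|exact: mean_dot ess_bounded_AD].
rewrite phiA phi_centered.
have -> : dotmx v 0 = 0 by rewrite dotmxC -(scale0r v) dotmxZl mul0r.
have h1 := hK1 s hs; have h2 := hK2 s hs; have h3 := hK3 s hs.
rewrite -/v -/step_weight in h1 *.
have h1' := ler_wpM2l (ltW eta_gt0) h1.
have h2' : c1 * nsq (centered s) <= c1 * (K2 * disagreement s) by rewrite ler_wpM2l.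
have h3' : eta ^+ 2 * (c2 * nsq (direction s)) <= eta ^+ 2 * (c2 * (K3 * total_err s)).
  by rewrite ler_wpM2l ?sqr_ge0// ler_wpM2l.
have [[[a_ge0 b_ge0] c_ge0] d_ge0] := err_ge0 s.
have f_ge0 : 0 <= fast_err s by rewrite /fast_err; lra.
have t_ge0 : 0 <= total_err s by rewrite /total_err; lra.
have x1 : 0 <= eta * ((2 * c1 * K2 + 2 * c2 * K3) * fast_err s).
  by apply: mulr_ge0; [exact: ltW|apply: mulr_ge0 => //; lra].
have x2 : 0 <= (K1 + 2 * c2 * K3) * disagreement s by apply: mulr_ge0 => //; lra.
have x3 : 0 <= eta ^+ 2 * ((K1 + 2 * c1 * K2) * total_err s).
  by apply: mulr_ge0; [exact: sqr_ge0|apply: mulr_ge0 => //; lra].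
lra.
Qed.

Lemma mean_disagreement : exists2 K : R, 0 <= K &
  forall s, balanced s -> forall eta, 0 < eta ->
  mean_le P (fun w => disagreement (next eta w s))
    ((1 - b0 ^+ 2) * disagreement s + eta ^+ 2 * (K * total_err s)).
Proof.
have [b0_gt0 b0_le] := andP b0_bnd.
have [K K_ge0 hK] := direction_total.
pose c := (1 + b0^-1) * ((1 + nsq (var_mx phi)) * (n%:R * n%:R) ^+ 2).
have c_ge0 : 0 <= c.
  apply: mulr_ge0; first by rewrite addr_ge0// invr_ge0 ltW.
  apply: mulr_ge0; first by rewrite addr_ge0// nsq_ge0.
  by rewrite exprn_ge0// mulr_ge0.
exists (c * K); first exact: mulr_ge0.
move=> s hs eta eta_gt0.
apply: (@mean_le_ae _ _ _ _ _ (fun w => (1 + b0) * qf (var_mx phi) (A w *m s.1.1.1)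
   + eta ^+ 2 * (c * nsq (direction s)))).
  move: nsq_AD; apply: filterS => w hAD.
  rewrite /disagreement /= next_XE; apply: le_trans (qf_young _ _ _ b0_gt0) _.
    by move=> X; exact: qf_var_mx_ge0.
  rewrite lerD2l -scaleNr qfZ sqrrN mulrCA ler_wpM2l ?sqr_ge0// /c -mulrA.
  rewrite ler_wpM2l ?addr_ge0 ?invr_ge0 ?(ltW b0_gt0)// -mulrA.
  apply: le_trans (qf_le_nsq _ _) _.
  by rewrite ler_wpM2l ?addr_ge0 ?nsq_ge0.
apply: mean_le_ub; last first.
  apply: mean_leD; last exact: mean_le_cst.
  apply: mean_leZ (A_contr _); lra.
have h3 : eta ^+ 2 * (c * nsq (direction s)) <= eta ^+ 2 * (c * (K * total_err s)).
  by rewrite ler_wpM2l ?sqr_ge0// ler_wpM2l// hK.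
have -> : (1 + b0) * ((1 - b0) * qf (var_mx phi) s.1.1.1)
   = (1 - b0 ^+ 2) * disagreement s by rewrite /disagreement; ring.
by rewrite lerD2l -(mulrA c).
Qed.

(** The push-sum weights move by the same [B], hence the residual becomes [B] times
    a matrix with zero column sums plus the projected increment. *)
Lemma mean_track_err : exists2 K : R, 0 <= K & forall s, balanced s -> forall eta,
  mean_le P (fun w => track_err (next eta w s))
    ((1 - e0 ^+ 2) * track_err s + K * staleness s).
Proof.
have [e0_gt0 e0_le] := andP e0_bnd.
have Q_ge0 q (X : 'M[R]_(n, q)) : 0 <= qf Q X := le_trans (nsq_ge0 X) (Q_contr X).1.
have [K' K'_ge0 hK'] : dom (fun s => n%:R * n%:R * nsq (increment s)) staleness.
  by apply: dominatedZ; [rewrite mulr_ge0|exact: increment_staleness].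
pose c1 := 2 * nsq (1%:M : 'M[R]_n) + 2 * (n%:R * nsq u).
have c1_ge0 : 0 <= c1.
  by apply: addr_ge0; do ?apply: mulr_ge0 => //; exact: nsq_ge0.
pose c := (1 + e0^-1) * ((1 + nsq Q) * ((n%:R * n%:R) * c1)).
have c_ge0 : 0 <= c.
  apply: mulr_ge0; first by rewrite addr_ge0// invr_ge0 ltW.
  apply: mulr_ge0; first by rewrite addr_ge0// nsq_ge0.
  by apply: mulr_ge0 => //; exact: mulr_ge0.
exists (c * K'); first exact: mulr_ge0.
move=> s hs eta.
have [w_ge0 w1 _] := hs.
have res0 : u *m residual s = 0.
  rewrite /residual mulmxBr (mulmxA u s.2) w1.
  have -> : (const_mx 1 : 'M[R]_1) = 1%:M.
    by apply/matrixP => i j; rewrite (ord1 i) (ord1 j) !mxE eqxx.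
  by rewrite mul1mx subrr.
pose W w := (1%:M - s.2 *m u) *m (D w *m increment s).
have nsqW w : nsq (W w) <= c1 * (K' * staleness s).
  apply: le_trans (nsqM _ _) _; rewrite ler_pM ?nsq_ge0//.
    apply: le_trans (nsqB_le _ _) _; rewrite lerD2l ler_wpM2l//.
    apply: le_trans (nsqM _ _) _; rewrite ler_wpM2r ?nsq_ge0//.
    exact: weights_bounded.
  apply: le_trans (nsqM _ _) _; apply: le_trans (hK' s hs).
  by rewrite ler_wpM2r ?nsq_ge0// nsq_D.
apply: (@mean_le_ae _ _ _ _ _ (fun w => (1 + e0) * qf Q (B w *m residual s)
   + c * (K' * staleness s))).
  move: B_st; apply: filterS => w [B_ge0 uB].
  have -> : track_err (next eta w s) = qf Q (B w *m residual s + B w *m W w).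
    rewrite /track_err; congr qf; rewrite -mulmxDr /residual /=.
    rewrite /next_Y (mulmxA u) uB -mulmxA -mulmxBr; congr (_ *m _).
    rewrite /W mulmxBl mul1mx -(mulmxA s.2 u); move: (D w *m increment s) => z.
    rewrite (mulmxDr u) (mulmxDr s.2).
    move: (s.2 *m (u *m s.1.1.2)) (s.2 *m (u *m z)) => x y.
    by apply/matrixP => i j; rewrite !mxE; ring.
  apply: le_trans (qf_young _ _ (@Q_ge0 _) e0_gt0) _; rewrite lerD2l /c -!mulrA.
  rewrite ler_wpM2l ?addr_ge0 ?invr_ge0 ?(ltW e0_gt0)//.
  apply: le_trans (qf_le_nsq _ _) _; rewrite ler_wpM2l ?addr_ge0 ?nsq_ge0//.
  apply: le_trans (nsqM _ _) _; rewrite mulrA ler_pM ?nsq_ge0//.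
  apply: nsq_unit_entries => i j; rewrite B_ge0 /=.
  have -> : B w i j = (B w)^T j i by rewrite mxE.
  apply: entry_le1 => [k l|]; first by rewrite mxE.
  by rewrite -[LHS]trmxK trmx_mul trmxK !trmx_const uB trmx_const.
apply: mean_le_ub; last first.
  apply: mean_leD; last exact: mean_le_cst.
  apply: mean_leZ ((Q_contr _).2 res0); lra.
rewrite -(mulrA c) lerD2r /track_err.
by rewrite le_eqVlt; apply/orP; left; apply/eqP; ring.
Qed.

(** The rows of active nodes are refreshed; in the mean this removes a fraction of
    the staleness at least the smallest activation probability. *)
Lemma mean_staleness : exists2 g : R, 0 < g & exists2 K : R, 0 <= K &
  forall s, balanced s -> forall eta, 0 < eta ->
  mean_le P (fun w => staleness (next eta w s))
    ((1 - g) * staleness s + K * disagreement s + eta ^+ 2 * (K * total_err s)).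
Proof.
have [p0 p0_gt0 p0_le] := pos_family_lower_bound D_mean.
pose g := Num.min p0 2^-1.
have g_gt0 : 0 < g by rewrite lt_min p0_gt0 invr_gt0 ltr0n.
have g_le : g <= 2^-1 by rewrite ge_min lexx orbT.
have [K1 K1_ge0 hK1] := centered_disagreement; have [K2 K2_ge0 hK2] := direction_total.
pose c0 := 2 * (n%:R * n%:R) + 2 * nsq (1%:M : 'M[R]_n).
have nn_ge0 : 0 <= n%:R * n%:R :> R by exact: mulr_ge0.
have c0_ge0 : 0 <= c0 by apply: addr_ge0; apply: mulr_ge0 => //; exact: nsq_ge0.
pose c1 := (1 + g^-1) * (2 * c0); pose c2 := (1 + g^-1) * (2 * (n%:R * n%:R) ^+ 2).
have g1 : 0 <= 1 + g^-1 by rewrite addr_ge0// invr_ge0 ltW.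
have c1_ge0 : 0 <= c1 by apply: mulr_ge0 => //; exact: mulr_ge0.
have c2_ge0 : 0 <= c2 by do 2!apply: mulr_ge0 => //; exact: exprn_ge0.
exists (g ^+ 2); first exact: exprn_gt0.
exists (c1 * K1 + c2 * K2); first by rewrite addr_ge0// mulr_ge0.
move=> s hs eta eta_gt0; pose E := s.1.1.1 - s.1.2.
apply: (@mean_le_ae _ _ _ _ _ (fun w =>
    (1 + g) * nsq ((1%:M - D w) *m E)
    + (c1 * nsq (centered s) + eta ^+ 2 * (c2 * nsq (direction s))))).
  move: nsq_A nsq_AD A_st; apply: filterS3 => w hA1 hAD [_ Ao].
  have -> : staleness (next eta w s) = nsq ((1%:M - D w) *m E +
      ((A w - 1%:M) *m centered s - eta *: (A w *m D w *m direction s))).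
    rewrite /staleness /= next_XE /next_C /E /centered; congr nsq.
    rewrite (mulmxBr (A w - 1%:M)) (mulmxBl (A w) 1%:M (o *m _)) (mulmxA (A w) o) Ao mul1mx subrr subr0.
    rewrite mulmxBr !mulmxBl !mul1mx.
    set a := A w *m s.1.1.1; set b := _ *: _; set x := D w *m _; set y := D w *m _.
    apply/matrixP => i j; rewrite !mxE; ring.
  apply: le_trans (nsqD_young _ _ g_gt0) _; rewrite lerD2l.
  have h := nsqB_le ((A w - 1%:M) *m centered s) (eta *: (A w *m D w *m direction s)).
  rewrite nsqZ in h.
  have h1 : nsq ((A w - 1%:M) *m centered s) <= c0 * nsq (centered s).
    apply: le_trans (nsqM _ _) _; rewrite ler_wpM2r ?nsq_ge0//.
    by apply: le_trans (nsqB_le _ _) _; rewrite lerD2r ler_wpM2l.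
  have h2 : eta ^+ 2 * nsq (A w *m D w *m direction s)
     <= eta ^+ 2 * ((n%:R * n%:R) ^+ 2 * nsq (direction s)) by rewrite ler_wpM2l ?sqr_ge0.
  apply: (@le_trans _ _ ((1 + g^-1) * (2 * (c0 * nsq (centered s))
      + 2 * (eta ^+ 2 * ((n%:R * n%:R) ^+ 2 * nsq (direction s)))))).
    by rewrite ler_wpM2l//; lra.
  by rewrite /c1 /c2 le_eqVlt; apply/orP; left; apply/eqP; ring.
have mD : mean_le P (fun w => nsq ((1%:M - D w) *m E)) ((1 - g) * staleness s).
  have rowE w i : nsq (row i ((1%:M - D w) *m E)) = (1 - D w i i) * nsq (row i E).
    have -> : row i ((1%:M - D w) *m E) = (1 - D w i i) *: row i E.
      apply/rowP => j; rewrite mulmxBl mul1mx !mxE.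
      rewrite (bigD1 i)//= big1 ?addr0.
        by rewrite !mxE eqxx; ring.
      by move=> k /negPf ki; rewrite !mxE eq_sym ki mulr0n mul0r.
    rewrite nsqZ; congr (_ * _); rewrite !mxE eqxx.
    by case: (i \in V w); rewrite ?subrr ?subr0 ?expr0n ?expr1n.
  under eq_fun do rewrite nsq_rows.
  rewrite /staleness nsq_rows mulr_sumr; apply: mean_le_sum => i.
  under eq_fun do rewrite rowE mulrC.
  rewrite -/E mulrC; apply: mean_leZ; first exact: nsq_ge0.
  have iD : P.-integrable setT (EFin \o (fun w => D w i i)) by exact: ess_bounded_integrable.
  have i1 : P.-integrable setT (EFin \o (fun=> 1 : R)).
    exact/ess_bounded_integrable/ess_bounded_cst.
  apply: mean_le_ub (mean_le_int (int_funB i1 iD)).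
  by rewrite RintegralB// Rint_cst lerD2l lerN2 ge_min p0_le.
apply: mean_le_ub; last first.
  by apply: mean_leD; [apply: mean_leZ mD; lra|exact: mean_le_cst].
have [[[a_ge0 b_ge0] c_ge0] d_ge0] := err_ge0 s.
have t_ge0 : 0 <= total_err s by rewrite /total_err; lra.
have h1 : c1 * nsq (centered s) <= c1 * (K1 * disagreement s) by rewrite ler_wpM2l// hK1.
have h2 : eta ^+ 2 * (c2 * nsq (direction s)) <= eta ^+ 2 * (c2 * (K2 * total_err s)).
  by rewrite ler_wpM2l ?sqr_ge0// ler_wpM2l// hK2.
have x1 : 0 <= c2 * K2 * disagreement s by apply: mulr_ge0 => //; exact: mulr_ge0.
have x2 : 0 <= eta ^+ 2 * (c1 * K1 * total_err s).
  by apply: mulr_ge0; [exact: sqr_ge0|apply: mulr_ge0 => //; exact: mulr_ge0].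
have -> : (1 + g) * ((1 - g) * staleness s) = (1 - g ^+ 2) * staleness s by ring.
lra.
Qed.

Definition lyapunov (wb wc : R) s : R :=
  opt_err s + (wb * disagreement s + (wc * staleness s + track_err s)).

Lemma lyapunov_ge0 wb wc s : 0 < wb -> 0 < wc -> 0 <= lyapunov wb wc s.
Proof.
move=> wb0 wc0; have [[[a_ge0 b_ge0] c_ge0] d_ge0] := err_ge0 s.
have hb : 0 <= wb * disagreement s by rewrite mulr_ge0// ltW.
have hc : 0 <= wc * staleness s by rewrite mulr_ge0// ltW.
by rewrite /lyapunov; lra.
Qed.

Lemma node_dist_lyapunov wb wc : 0 < wb -> 0 < wc -> exists2 K : R, 0 <= K &
  forall s i, nsq (row i s.1.1.1 - xs) <= K * lyapunov wb wc s.
Proof.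
move=> wb0 wc0; have [d0 d0_gt0 dle] := pos_family_lower_bound phi_gt0.
pose k := 2 * nsq o.
have k_ge0 : 0 <= k by apply: mulr_ge0 => //; exact: nsq_ge0.
have c_ge0 : 0 <= 2 * (d0^-1 / wb).
  by apply: mulr_ge0 => //; rewrite divr_ge0 ?invr_ge0 ?ltW.
exists (k + 2 * (d0^-1 / wb)); first exact: addr_ge0.
move=> s i; have [[[a_ge0 b_ge0] c'_ge0] d_ge0] := err_ge0 s.
have hb : 0 <= wb * disagreement s by rewrite mulr_ge0// ltW.
have hc : 0 <= wc * staleness s by rewrite mulr_ge0// ltW.
have -> : row i s.1.1.1 - xs = row i (centered s + o *m (phi *m s.1.1.1 - xs)).
  rewrite /centered mulmxBr addrA subrK linearB /=.
  by rewrite row_const_mul.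
apply: le_trans (nsq_row_le _ _) _; apply: le_trans (nsqD_le _ _) _.
have h1 : nsq (centered s) <= d0^-1 * disagreement s by exact: nsq_centered_le.
have h2 : nsq (o *m (phi *m s.1.1.1 - xs)) <= nsq o * opt_err s by exact: nsqM.
have h3 : d0^-1 * disagreement s = d0^-1 / wb * (wb * disagreement s).
  by rewrite mulrA divfK// gt_eqF.
rewrite h3 in h1.
have l_ge : wb * disagreement s <= lyapunov wb wc s by rewrite /lyapunov; lra.
have l_ge2 : opt_err s <= lyapunov wb wc s by rewrite /lyapunov; lra.
have h4 := ler_wpM2l k_ge0 l_ge2.
have h5 := ler_wpM2l c_ge0 l_ge.
rewrite /k in h4 *; move: h1 h4 h5; set r := d0^-1 / wb; set y := wb * _ => h1 h4 h5.
lra.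
Qed.

Lemma mean_lyapunov : exists wb wc eta0 : R, [/\ 0 < wb, 0 < wc, 0 < eta0 &
  forall eta, 0 < eta -> eta <= eta0 -> exists2 rho : R, 0 < rho < 1 &
  forall s, balanced s ->
    mean_le P (fun w => lyapunov wb wc (ext_step gF eta (V w) (A w) (B w) s))
              (rho * lyapunov wb wc s)].
Proof.
have [theta th0 [K1 K1_ge0 h1]] := mean_opt_err.
have [K2 K2_ge0 h2] := mean_disagreement.
have [g g0 [K3 K3_ge0 h3]] := mean_staleness.
have [K4 K4_ge0 h4] := mean_track_err.
pose K := K1 + K2 + K3 + K4.
have K_ge0 : 0 <= K by rewrite !addr_ge0.
have K1K x : 0 <= x -> K1 * x <= K * x by move=> hx; rewrite ler_wpM2r// /K; lra.
have K2K x : 0 <= x -> K2 * x <= K * x by move=> hx; rewrite ler_wpM2r// /K; lra.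
have K3K x : 0 <= x -> K3 * x <= K * x by move=> hx; rewrite ler_wpM2r// /K; lra.
have K4K x : 0 <= x -> K4 * x <= K * x by move=> hx; rewrite ler_wpM2r// /K; lra.
have be0 : 0 < b0 ^+ 2 by rewrite exprn_gt0//; case/andP: b0_bnd.
have de0 : 0 < e0 ^+ 2 by rewrite exprn_gt0//; case/andP: e0_bnd.
have [wb [wc [eta0 [wb0 wc0 eta0_gt0 contr]]]] := weighted_contraction K_ge0 th0 be0 g0 de0.
exists wb, wc, eta0; split => // eta eta_gt0 eta_le.
have [rho rho01 hrho] := contr eta eta_gt0 eta_le; exists rho => // s hs.
have [[[a_ge0 b_ge0] c_ge0] d_ge0] := err_ge0 s.
have f_ge0 : 0 <= fast_err s by rewrite /fast_err; lra.
have t_ge0 : 0 <= total_err s by rewrite /total_err; lra.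
apply: mean_le_ub (hrho _ _ _ _ a_ge0 b_ge0 c_ge0 d_ge0) _.
have tK (Ki : R) : (forall x, 0 <= x -> Ki * x <= K * x) ->
    eta ^+ 2 * (Ki * total_err s) <= eta ^+ 2 * (K * total_err s).
  by move=> hKi; rewrite ler_wpM2l ?sqr_ge0// hKi.
apply: (mean_leD (g := fun w => opt_err (next eta w s))).
  apply: mean_le_ub (h1 s hs eta eta_gt0).
  by rewrite !lerD ?tK ?K1K// ler_wpM2l ?K1K// ltW.
apply: (mean_leD (g := fun w => wb * disagreement (next eta w s))).
  apply: mean_leZ; first exact: ltW.
  by apply: mean_le_ub (h2 s hs eta eta_gt0); rewrite lerD ?tK.
apply: (mean_leD (g := fun w => wc * staleness (next eta w s))).
  apply: mean_leZ; first exact: ltW.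
  by apply: mean_le_ub (h3 s hs eta eta_gt0); rewrite !lerD ?tK ?K3K.
by apply: mean_le_ub (h4 s hs eta); rewrite lerD ?K4K.
Qed.

End OneStep.

(** * Recursions driven by independent draws *)

Section Recursion.
Context d (T : measurableType d) (R : realType) (P : probability T R).
Context d1 (S : measurableType d1) d2 (Z : measurableType d2).

(** Dynkin's theorem: the sets satisfying the product rule form a Dynkin system. *)
Lemma independent_of_pair (f : T -> S) (g : T -> Z) (E : set T) :
  measurable_fun setT f -> measurable_fun setT g -> measurable E ->
  (forall F G, measurable F -> measurable G ->
     P (f @^-1` F `&` g @^-1` G `&` E) = (P (f @^-1` F `&` g @^-1` G) * P E)%E) ->
  forall H : set (S * Z), measurable H ->
    P ((fun w => (f w, g w)) @^-1` H `&` E) = (P ((fun w => (f w, g w)) @^-1` H) * P E)%E.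
Proof.
move=> mf mg mE rect.
pose h w := (f w, g w).
have mh : measurable_fun setT h by exact: measurable_fun_pair.
have mhH H : measurable H -> measurable (h @^-1` H).
  by move=> mH; rewrite -[X in measurable X]setTI; exact: mh.
rewrite -/h => H; rewrite measurable_prod_measurableType; move: H.
apply: dynkin_induction => //=.
- by rewrite measurable_prod_measurableType.
- move=> _ _ [A1 mA1 [A2 mA2 <-]] [B1 mB1 [B2 mB2 <-]].
  exists (A1 `&` B1); first exact: measurableI.
  exists (A2 `&` B2); first exact: measurableI.
  by rewrite setXI.
- by rewrite preimage_setT setTI probability_setT mul1e.
- by move=> _ [F mF [G mG <-]]; exact: rect.
- move=> H mH HE.
  have -> : h @^-1` (~` H) = ~` (h @^-1` H) by [].
  have mA := mhH _ mH; move: mA HE; set A := h @^-1` H => mA HE.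
  rewrite setIC -setDE measureD//; last by rewrite ltey_eq fin_num_measure.
  transitivity (P E - P A * P E)%E; first by congr (_ - _)%E; rewrite setIC.
  by rewrite probability_setC// muleBl ?mul1e// fin_num_measure.
- move=> F mF tF HF.
  rewrite preimage_bigcup setI_bigcupl.
  rewrite measure_semi_bigcup//; last 3 first.
  - by move=> k; apply: measurableI => //; exact: mhH.
  - apply/trivIsetP => i j _ _ ij.
    rewrite setIACA setIid -preimage_setI.
    by move/trivIsetP : tF => /(_ _ _ _ _ ij) ->//; rewrite preimage_set0 set0I.
  - by apply: bigcup_measurable => k _; apply: measurableI => //; exact: mhH.
  rewrite measure_semi_bigcup//; last 3 first.
  - by move=> k; exact: mhH.
  - apply/trivIsetP => i j _ _ ij; rewrite -preimage_setI.
    by move/trivIsetP : tF => /(_ _ _ _ _ ij) ->//; rewrite preimage_set0.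
  - by apply: bigcup_measurable => k _; exact: mhH.
  rewrite muleC -[X in (X * _)%E]fineK ?fin_num_measure// -nneseriesZl//.
  by apply: eq_eseriesr => k _; rewrite fineK ?fin_num_measure// muleC; exact: HF.
Qed.

Variables (zeta : nat -> T -> Z) (step : S * Z -> S) (s0 : S).
Hypothesis zeta_iid : iid P [set t | (1 <= t)%N] zeta.
Hypothesis mstep : measurable_fun setT step.

Fixpoint driven_state (k : nat) (w : T) : S :=
  if k is k'.+1 then step (driven_state k' w, zeta k w) else s0.

Lemma measurable_zeta t : (1 <= t)%N -> measurable_fun setT (zeta t).
Proof. by case: zeta_iid => + _ _; exact. Qed.

Lemma measurable_driven_state k : measurable_fun setT (driven_state k).
Proof.
elim: k => [|k IH]; first exact: measurable_cst.
apply: (measurableT_comp mstep) => /=; apply: measurable_fun_pair => //.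
exact: measurable_zeta.
Qed.

(** Quantifying over finitely many later draws makes the induction work: the next
    state is a function of the pair (state, draw), and [independent_of_pair]
    reduces its events to rectangles, where the draw joins the later ones. *)
Lemma driven_state_independent k (F : set S) (s : seq nat) (E : nat -> set Z) :
  measurable F -> uniq s -> (forall t, t \in s -> (k < t)%N) ->
  (forall t, measurable (E t)) ->
  P (driven_state k @^-1` F `&` \bigcap_(t in [set` s]) (zeta t @^-1` E t)) =
  (P (driven_state k @^-1` F) * \prod_(t <- s) P (zeta t @^-1` E t))%E.
Proof.
have [_ indep _] := zeta_iid.
have prodE r (G : nat -> set Z) : uniq r -> (forall t, t \in r -> (1 <= t)%N) ->
    (forall t, measurable (G t)) ->
    P (\bigcap_(t in [set` r]) (zeta t @^-1` G t)) =
      (\prod_(t <- r) P (zeta t @^-1` G t))%E.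
  by move=> ur rk mG; exact: indep.
elim: k F s E => [|k IH] F s E mF us sk mE.
  have [Fs0|Fs0] := pselect (F s0).
    have -> : driven_state 0 @^-1` F = setT by apply/seteqP; split => w.
    by rewrite setTI probability_setT mul1e prodE.
  have -> : driven_state 0 @^-1` F = set0 by apply/seteqP; split => w.
  by rewrite set0I measure0 mul0e.
have sk' t : t \in s -> (1 <= t)%N by move=> /sk; case: t.
have mQ : measurable (\bigcap_(t in [set` s]) (zeta t @^-1` E t)).
  apply: fin_bigcap_measurable => // t /= /sk' ht.
  by rewrite -[X in measurable X]setTI; exact: measurable_zeta.
rewrite -(prodE s E)//.
rewrite -[driven_state k.+1 @^-1` F]/((fun w => (driven_state k w, zeta k.+1 w)) @^-1` (step @^-1` F)).
apply: independent_of_pair => //.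
- exact: measurable_driven_state.
- exact: measurable_zeta.
- move=> G H mG mH.
  have kns : k.+1 \notin s by apply/negP => /sk; rewrite ltnn.
  (* The events of [s] together with that of the draw [k.+1]. *)
  pose E' t := if t == k.+1 then H else E t.
  have E's t : t \in s -> E' t = E t.
    by move=> ts; rewrite /E'; case: eqP => // tk; rewrite tk (negPf kns) in ts.
  have mE' t : measurable (E' t) by rewrite /E'; case: eqP.
  have -> : driven_state k @^-1` G `&` zeta k.+1 @^-1` H `&`
      \bigcap_(t in [set` s]) (zeta t @^-1` E t) =
      driven_state k @^-1` G `&` \bigcap_(t in [set` k.+1 :: s]) (zeta t @^-1` E' t).
    apply/seteqP; split => w /=.
      move=> [[Gw Hw] sw]; split => // t /=; rewrite inE => /orP[/eqP ->|ts].
        by rewrite /E' eqxx.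
      by rewrite E's//; exact: sw.
    move=> [Gw sw]; split; [split => //|].
      by have := sw k.+1; rewrite /= inE eqxx /E' eqxx; exact.
    by move=> t /= ts; rewrite -E's//; apply: sw; rewrite /= inE ts orbT.
  have IHs r := IH _ r E' mG.
  rewrite IHs//=; last 2 first.
  - by rewrite kns us.
  - by move=> t; rewrite inE => /orP[/eqP ->//|/sk /ltnW].
  have -> : driven_state k @^-1` G `&` zeta k.+1 @^-1` H =
      driven_state k @^-1` G `&` \bigcap_(t in [set` [:: k.+1]]) (zeta t @^-1` E' t).
    apply/seteqP; split => w /= [Gw Hw]; split => //.
      by move=> t /=; rewrite inE => /eqP ->; rewrite /E' eqxx.
    by have := Hw k.+1; rewrite /= inE eqxx /E' eqxx; exact.
  rewrite IHs//=; last first.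
    by move=> t; rewrite inE => /eqP ->.
  rewrite big_cons big_seq1 muleA; congr (_ * _)%E.
  by rewrite prodE//; apply: eq_big_seq => t ts; rewrite E's.
- by rewrite -[X in measurable X]setTI; exact: mstep.
Qed.

Lemma measurable_mean_next k (g : S * Z -> \bar R) : measurable_fun setT g ->
  (forall x, (0 <= g x)%E) ->
  measurable_fun setT (fun w => \int[P]_w' g (driven_state k w, zeta 1 w'))%E.
Proof.
move=> mg g0; have mz1 : measurable_fun setT (zeta 1) by exact: measurable_zeta.
pose Xz : {mfun T >-> Z} := HB.pack (zeta 1) (isMeasurableFun.Build _ _ _ _ _ mz1).
have mF : measurable_fun setT (fubini_F (distribution P Xz) g).
  exact: measurable_fun_fubini_tonelli_F.
apply: eq_measurable_fun (measurableT_comp mF (measurable_driven_state k)) => w _ /=.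
rewrite /fubini_F ge0_integral_distribution//.
by apply: measurableT_comp => //; exact: measurable_fun_pair.
Qed.

(** By independence and equality in law, the next draw may be replaced by a fresh copy
    of the first one. *)
Lemma driven_state_fubini k (g : S * Z -> \bar R) : measurable_fun setT g ->
  (forall x, (0 <= g x)%E) ->
  (\int[P]_w g (driven_state k w, zeta k.+1 w) =
   \int[P]_w \int[P]_w' g (driven_state k w, zeta 1 w'))%E.
Proof.
move=> mg g0; have [_ _ same] := zeta_iid.
have mz1 : measurable_fun setT (zeta 1) by exact: measurable_zeta.
have ms := measurable_driven_state k.
have mz : measurable_fun setT (zeta k.+1) by exact: measurable_zeta.
have mp : measurable_fun setT (fun w => (driven_state k w, zeta k.+1 w)).
  exact: measurable_fun_pair.
pose Xs : {mfun T >-> S} := HB.pack (driven_state k) (isMeasurableFun.Build _ _ _ _ _ ms).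
pose Xz : {mfun T >-> Z} := HB.pack (zeta 1) (isMeasurableFun.Build _ _ _ _ _ mz1).
pose Xp : {mfun T >-> (S * Z)%type} :=
  HB.pack (fun w => (driven_state k w, zeta k.+1 w)) (isMeasurableFun.Build _ _ _ _ _ mp).
transitivity (\int[distribution P Xp]_x g x)%E.
  by rewrite ge0_integral_distribution.
transitivity (\int[distribution P Xs \x distribution P Xz]_x g x)%E.
  apply: eq_measure_integral => A mA _; apply/esym.
  apply: product_measure_unique => // F G mF mG.
  rewrite /distribution /pushforward /=.
  have := @driven_state_independent k F [:: k.+1] (fun=> G) mF isT _ (fun=> mG).
  rewrite big_seq1 (same k.+1 1%N)//.
  have -> : \bigcap_(t in [set` [:: k.+1]]) (zeta t @^-1` G) = zeta k.+1 @^-1` G.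
    apply/seteqP; split => w /=; first by apply; rewrite /= inE.
    by move=> Gw t /=; rewrite inE => /eqP ->.
  by move=> <- // t; rewrite inE => /eqP ->.
rewrite fubini_tonelli1//= /fubini_F.
rewrite ge0_integral_distribution//; last 2 first.
- exact: measurable_fun_fubini_tonelli_F.
- by move=> x; exact: integral_ge0.
apply: eq_integral => w _ /=; rewrite ge0_integral_distribution//.
by apply: measurableT_comp => //; exact: measurable_fun_pair.
Qed.

End Recursion.

(** * Borel sets of matrices *)

Section BorelMatrices.
Variable R : realType.

(** For square matrices this is convertible to [borel_mx]. *)
Definition mx_borel m q := g_sigma_algebraType (@open 'M[R]_(m, q)).
HB.instance Definition _ m q := Measurable.on (mx_borel m q).

Lemma measurable_continuous_mx m q (h : 'M[R]_(m, q) -> R) : continuous h ->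
  measurable_fun setT (h : mx_borel m q -> R).
Proof.
move=> /continuousP ch; apply: (measurability _ (RGenOpens.measurableE R)).
move=> _ [_ [a [b ->]] <-]; rewrite setTI; apply: sub_sigma_algebra.
exact: ch.
Qed.

Lemma sqr_lipschitz_continuous m q (h : 'M[R]_(m, q) -> R) (C : R) :
  (forall M N, (h M - h N) ^+ 2 <= C * nsq (M - N)) -> continuous h.
Proof.
move=> hC M; have FM := nbhs_filter M.
apply/(@cvgrPdist_lt _ _ _ _ FM) => e e_gt0.
pose c := (1 + `|C|) * (1 + m%:R * q%:R).
have c_gt0 : 0 < c by rewrite mulr_gt0// ltr_pwDl// mulr_ge0.
pose r := Num.min 1 (e ^+ 2 / c / 2).
have r_gt0 : 0 < r by rewrite lt_min ltr01 !divr_gt0// exprn_gt0.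
apply/nbhs_ballP; exists r => //= N [_ MN].
have sq : nsq (M - N) <= m%:R * q%:R * r.
  rewrite /nsq; apply: (@le_trans _ _ (\sum_(i < m) \sum_(j < q) r)).
    apply: ler_sum => i _; apply: ler_sum => j _.
    have := MN i j; rewrite /ball /= => lt_r; rewrite !mxE.
    rewrite -real_normK ?num_real// expr2.
    apply: (@le_trans _ _ (r * 1)); last by rewrite mulr1.
    by rewrite ler_pM ?(ltW lt_r)// (le_trans (ltW lt_r))// ge_min lexx.
  by rewrite !sumr_const !card_ord -mulrnA -[leLHS]mulr_natl mulnC natrM.
have lt2 : (h M - h N) ^+ 2 < e ^+ 2.
  apply: le_lt_trans (hC M N) _.
  apply: (@le_lt_trans _ _ (c * r)).
    apply: (@le_trans _ _ (`|C| * (m%:R * q%:R * r))).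
      apply: le_trans (ler_wpM2r (nsq_ge0 _) (ler_norm C)) _.
      by rewrite ler_wpM2l.
    rewrite mulrA ler_wpM2r ?(ltW r_gt0)// /c ler_pM ?mulr_ge0//.
      by rewrite lerDr.
    by rewrite lerDr.
  apply: (@le_lt_trans _ _ (c * (e ^+ 2 / c / 2))).
    by rewrite ler_wpM2l ?(ltW c_gt0)// ge_min lexx orbT.
  have -> : c * (e ^+ 2 / c / 2) = e ^+ 2 / 2 by field; rewrite gt_eqF.
  by rewrite gtr_pMr ?exprn_gt0// invf_lt1// ltr1n.
by rewrite -(ltr_pXn2r (n := 2)) ?nnegrE ?(ltW e_gt0)// real_normK ?num_real.
Qed.

(** Every open set of matrices is a countable union of boxes with rational corners. *)
Lemma measurable_mx d (S : measurableType d) m q (F : S -> mx_borel m q) :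
  (forall i j, measurable_fun setT (fun s => (F s : 'M[R]_(m, q)) i j)) ->
  measurable_fun setT F.
Proof.
move=> mF; apply: (@measurability _ _ S (mx_borel m q) setT F (@open 'M[R]_(m, q)) erefl).
move=> _ [U oU <-]; rewrite setTI.
pose box (c : 'M[rat * rat]_(m, q)) := [set M : 'M[R]_(m, q) |
  forall i j, ratr (c i j).1 < M i j < ratr (c i j).2].
pose G k : set S := if unpickle k is Some c then
  if pselect (box c `<=` U) then F @^-1` box c else set0 else set0.
have mbox c : measurable (F @^-1` box c).
  have -> : F @^-1` box c = \bigcap_(ij in [set: 'I_m * 'I_q])
      ((fun s => (F s : 'M[R]_(m, q)) ij.1 ij.2) @^-1`
         `]ratr (c ij.1 ij.2).1, ratr (c ij.1 ij.2).2[%classic).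
    apply/seteqP; split => s /= h.
      by move=> [i j] _ /=; rewrite in_itv/=; exact: h.
    by move=> i j; have /= := h (i, j) I; rewrite in_itv.
  apply: fin_bigcap_measurable => // ij _.
  by rewrite -[X in measurable X]setTI; apply: mF.
have -> : F @^-1` U = \bigcup_k G k.
  apply/seteqP; split => [s /= Us|s [k _]]; last first.
    rewrite /G; case: (unpickle k) => // c; by case: pselect => // cU /cU.
  move: oU; rewrite openE => /(_ _ Us); rewrite /interior /= => /nbhs_ballP[e /= e_gt0 eU].
  have lo i j : {x : rat | (F s : 'M[R]_(m, q)) i j - e < ratr x < (F s : 'M[R]_(m, q)) i j}.
    apply: cid; have /rat_in_itvoo[x] :
      (F s : 'M[R]_(m, q)) i j - e < (F s : 'M[R]_(m, q)) i j by rewrite gtrBl.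
    by rewrite in_itv /= => hx; exists x.
  have hi i j : {x : rat | (F s : 'M[R]_(m, q)) i j < ratr x < (F s : 'M[R]_(m, q)) i j + e}.
    apply: cid; have /rat_in_itvoo[x] :
      (F s : 'M[R]_(m, q)) i j < (F s : 'M[R]_(m, q)) i j + e by rewrite ltrDl.
    by rewrite in_itv /= => hx; exists x.
  (* A rational box around [F s] inside the ball of radius [e]. *)
  pose c : 'M[rat * rat]_(m, q) := \matrix_(i, j) (sval (lo i j), sval (hi i j)).
  exists (pickle c) => //; rewrite /G pickleK; case: pselect => [cU|] /=; last first.
    case=> N cN; apply: eU; split => // i j; have := cN i j; rewrite !mxE /=.
    case: (lo i j) => /= x /andP[x1 x2]; case: (hi i j) => /= y /andP[y1 y2] /andP[N1 N2].
    rewrite /ball /= ltr_norml; apply/andP; split; lra.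
  move=> i j; rewrite mxE /=; case: (lo i j) => /= x /andP[_ ->].
  by case: (hi i j) => /= y /andP[-> _].
apply: bigcupT_measurable => k; rewrite /G; case: (unpickle k) => // c.
by case: pselect => cU; [exact: mbox|exact: measurable0].
Qed.

Definition measurable_entries d (S : measurableType d) m q (F : S -> 'M[R]_(m, q)) :=
  forall i j, measurable_fun setT (fun s => F s i j).

Section Entries.
Context d (S : measurableType d).

Lemma measurable_entries_borel m q (F : S -> mx_borel m q) :
  measurable_fun setT F -> measurable_entries (F : S -> 'M[R]_(m, q)).
Proof.
move=> mF i j; have mc : measurable_fun setT ((fun M : 'M[R]_(m, q) => M i j) : mx_borel m q -> R).
  apply: measurable_continuous_mx; apply: (@sqr_lipschitz_continuous _ _ _ 1) => M N.
  by rewrite mul1r; have := sqr_le_nsq (M - N) i j; rewrite !mxE.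
exact: (measurableT_comp mc).
Qed.

Lemma measurable_entriesM m q r (F : S -> 'M[R]_(m, q)) (G : S -> 'M[R]_(q, r)) :
  measurable_entries F -> measurable_entries G -> measurable_entries (fun s => F s *m G s).
Proof.
move=> mF mG i j; under eq_fun do rewrite mxE.
by apply: measurable_sum => k; exact: measurable_funM.
Qed.

Lemma measurable_entriesD m q (F G : S -> 'M[R]_(m, q)) :
  measurable_entries F -> measurable_entries G -> measurable_entries (fun s => F s + G s).
Proof. by move=> mF mG i j; under eq_fun do rewrite mxE; exact: measurable_funD. Qed.

Lemma measurable_entriesN m q (F : S -> 'M[R]_(m, q)) :
  measurable_entries F -> measurable_entries (fun s => - F s).
Proof. by move=> mF i j; under eq_fun do rewrite mxE; exact: measurableT_comp. Qed.

Lemma measurable_entriesZ m q (c : R) (F : S -> 'M[R]_(m, q)) :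
  measurable_entries F -> measurable_entries (fun s => c *: F s).
Proof. by move=> mF i j; under eq_fun do rewrite mxE; exact: measurable_funM. Qed.

Lemma measurable_entries_tr m q (F : S -> 'M[R]_(m, q)) :
  measurable_entries F -> measurable_entries (fun s => (F s)^T).
Proof. by move=> mF i j; under eq_fun do rewrite mxE; exact: mF. Qed.

Lemma measurable_entries_cst m q (M : 'M[R]_(m, q)) : measurable_entries (fun _ : S => M).
Proof. by move=> i j; exact: measurable_cst. Qed.

Lemma measurable_trace n (F : S -> 'M[R]_n) :
  measurable_entries F -> measurable_fun setT (fun s => \tr (F s)).
Proof. by move=> mF; apply: measurable_sum => i; exact: mF. Qed.

Lemma measurable_nsq m q (F : S -> 'M[R]_(m, q)) :
  measurable_entries F -> measurable_fun setT (fun s => nsq (F s)).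
Proof.
move=> mF; apply: measurable_sum => i; apply: measurable_sum => j.
exact: measurable_funX.
Qed.

Lemma measurable_entries_gradF n p (f : 'I_n -> 'rV[R]_p -> R) (L : R)
    (F : S -> 'M[R]_(n, p)) :
  (forall i, smooth L (f i)) -> measurable_entries F ->
  measurable_entries (fun s => gradF f (F s)).
Proof.
move=> sf mF i j.
have mh : measurable_fun setT ((fun M => gradF f M i j) : mx_borel n p -> R).
  apply: measurable_continuous_mx; apply: (@sqr_lipschitz_continuous _ _ _ (L ^+ 2)) => M N.
  apply: le_trans (gradF_lipschitz sf M N).
  have -> : gradF f M i j - gradF f N i j = (gradF f M - gradF f N) i j by rewrite !mxE.
  exact: sqr_le_nsq.
exact: (measurableT_comp mh (measurable_mx mF)).
Qed.

End Entries.
End BorelMatrices.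

(** * From mean decay to convergence *)

Lemma primitive_mx_tr (R : realType) n (M : 'M[R]_n) : primitive_mx M -> primitive_mx M^T.
Proof.
move=> [M_ge0 [k k1 Mk]]; split=> [i j|]; first by rewrite mxE.
exists k => // i j.
suff -> : M^T ^+ k = (M ^+ k)^T by rewrite mxE.
elim: k {k1 Mk} => [|k IH]; first by rewrite !expr0 trmx1.
by rewrite exprS exprSr IH trmx_mul.
Qed.

Lemma column_stochastic_tr (R : realType) n (M : 'M[R]_n) :
  column_stochastic M -> row_stochastic M^T.
Proof.
move=> [M_ge0 uM]; split=> [i j|]; first by rewrite mxE.
by rewrite -[LHS]trmxK trmx_mul trmxK !trmx_const uM trmx_const.
Qed.

(** Rows of [gradF] only depend on the corresponding rows of the argument. *)
Lemma gradF_local (R : realType) n p (f : 'I_n -> 'rV[R]_p -> R) (V : {set 'I_n})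
    (X C : 'M[R]_(n, p)) :
  gradF f (active_mx R V *m X + (1%:M - active_mx R V) *m C) =
  active_mx R V *m gradF f X + (1%:M - active_mx R V) *m gradF f C.
Proof.
have rowE (Y Z : 'M[R]_(n, p)) i :
    row i (active_mx R V *m Y + (1%:M - active_mx R V) *m Z)
    = if i \in V then row i Y else row i Z.
  apply/rowP => j; rewrite mulmxBl mul1mx /active_mx !mul_diag_mx.
  case: ifP => iV; rewrite !mxE iV /=; ring.
apply/row_matrixP => i; rewrite rowK !rowE !rowK.
by case: ifP.
Qed.

Section Sequence.
Context d (T : measurableType d) (R : realType) (P : probability T R).

(** The means are summable, so the sum of the process has a finite mean and is
    almost surely finite; its terms then tend to 0. *)
Lemma geometric_means_cvg0 (g : nat -> T -> R) (c rho : R) :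
  (forall k, measurable_fun setT (g k)) -> (forall k w, 0 <= g k w) ->
  0 < rho < 1 -> 0 <= c ->
  (forall k, (\int[P]_w (g k w)%:E <= (c * rho ^+ k)%:E)%E) ->
  {ae P, forall w, g k w @[k --> \oo] --> 0}.
Proof.
move=> mg g0 /andP[rho0 rho1] c0 hg.
have mgE k : measurable_fun setT (fun w => (g k w)%:E) by exact/measurable_EFinP.
have gE0 k w : (0 <= (g k w)%:E)%E by rewrite lee_fin.
pose G w := (\sum_(k <oo) (g k w)%:E)%E.
have mG : measurable_fun setT G.
  by apply: ge0_emeasurable_sum => // k w _ _; exact: gE0.
have G0 w : (0 <= G w)%E by apply: nneseries_ge0.
have intG : P.-integrable setT G.
  apply/integrableP; split => //.
  under eq_integral do rewrite gee0_abs//.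
  rewrite integral_nneseries//.
  apply: (@le_lt_trans _ _ (c / (1 - rho))%:E); last by rewrite ltry.
  apply: lime_le.
    by apply: is_cvg_nneseries => k _ _; exact: integral_ge0.
  apply: nearW => N; apply: (@le_trans _ _ (\sum_(0 <= k < N) (c * rho ^+ k)%:E)%E).
    by apply: lee_sum.
  rewrite sumEFin lee_fin -mulr_sumr ler_wpM2l//.
  rewrite -[leRHS]mul1r ler_pdivlMr ?subr_gt0// mulrC.
  have -> : (1 - rho) * \sum_(0 <= k < N) rho ^+ k = 1 - rho ^+ N.
    elim: N => [|N IH]; first by rewrite big_geq// mulr0 expr0 subrr.
    by rewrite big_nat_recr//= mulrDr IH exprS; ring.
  by rewrite gerBl exprn_ge0// ltW.
have := integrable_ae measurableT intG; apply: filterS => w /(_ I) Gfin.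
apply: cvg_series_cvg_0; apply: nondecreasing_is_cvgn.
  by apply: nondecreasing_series => k _ _; exact: g0.
exists (fine (G w)) => _ [N _ <-].
rewrite -lee_fin fineK// /series /= -sumEFin.
exact: nneseries_lim_ge.
Qed.

End Sequence.

Lemma row_cvg (R : realType) p (x : nat -> 'rV[R]_p) (l : 'rV[R]_p) :
  nsq (x t - l) @[t --> \oo] --> (0 : R) -> x t @[t --> \oo] --> l.
Proof.
move=> h; apply/cvg_ballP => e e_gt0.
have e2 : 0 < e ^+ 2 by rewrite exprn_gt0.
move/cvgrPdist_lt: h => /(_ _ e2); apply: filterS => t.
rewrite sub0r normrN ger0_norm ?nsq_ge0// => ht; split => // i j.
rewrite /ball /= -(ltr_pXn2r (n := 2)) ?nnegrE ?(ltW e_gt0)// real_normK ?num_real//.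
rewrite -sqrrN opprB; apply: le_lt_trans ht.
by have := sqr_le_nsq (x t - l) i j; rewrite !mxE.
Qed.

(** * Measurability of the iteration *)

Section Measurability.
Variables (R : realType) (n p : nat).

Definition state_space :=
  (mx_borel R n p * mx_borel R n p * mx_borel R n p * mx_borel R n 1)%type.
HB.instance Definition _ := Measurable.on state_space.

Definition draw_space := (node_subset n * borel_mx R n * borel_mx R n)%type.
HB.instance Definition _ := Measurable.on draw_space.

Definition draw_step gF eta (x : state_space * draw_space) : state_space :=
  @ext_step R n p gF eta x.2.1.1 x.2.1.2 x.2.2 x.1.

Lemma measurable_active_mx d (S : measurableType d) (V : S -> node_subset n) :
  measurable_fun setT V -> measurable_entries (fun s => active_mx R (V s)).
Proof.
move=> mV i j.
have mh : measurable_fun setT ((fun U => active_mx R U i j) : node_subset n -> R) by [].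
exact: (measurableT_comp mh mV).
Qed.

Lemma measurable_draw_step gF eta :
  (forall d (S : measurableType d) (F : S -> 'M[R]_(n, p)),
     measurable_entries F -> measurable_entries (fun s => gF (F s))) ->
  measurable_fun setT (draw_step gF eta).
Proof.
move=> mgF.
have m1 : measurable_fun setT (fst : state_space * draw_space -> state_space).
  exact: measurable_fst.
have m2 : measurable_fun setT (snd : state_space * draw_space -> draw_space).
  exact: measurable_snd.
have m11 := measurableT_comp measurable_fst m1.
have m21 := measurableT_comp measurable_fst m2.
have mX := measurable_entries_borel
  (measurableT_comp measurable_fst (measurableT_comp measurable_fst m11)).
have mY := measurable_entries_borel
  (measurableT_comp measurable_snd (measurableT_comp measurable_fst m11)).
have mC := measurable_entries_borel (measurableT_comp measurable_snd m11).
have mw := measurable_entries_borel (measurableT_comp measurable_snd m1).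
have mV := measurable_active_mx (measurableT_comp measurable_fst m21).
have mA := @measurable_entries_borel R _ _ n n _ (measurableT_comp measurable_snd m21).
have mB := @measurable_entries_borel R _ _ n n _ (measurableT_comp measurable_snd m2).
have mYh := measurable_entriesD mY (measurable_entriesM mV
  (measurable_entriesD (mgF _ _ _ mX) (measurable_entriesN (mgF _ _ _ mC)))).
apply: measurable_fun_pair; last first.
  by apply: measurable_mx; exact: measurable_entriesM mB mw.
apply: measurable_fun_pair; last first.
  apply: measurable_mx; apply: measurable_entriesD.
    exact: measurable_entriesM mV mX.
  apply: measurable_entriesM mC; apply: measurable_entriesD (measurable_entriesN mV).
  exact: measurable_entries_cst.
apply: measurable_fun_pair; last first.
  by apply: measurable_mx; exact: measurable_entriesM mB mYh.
apply: measurable_mx; apply: measurable_entriesM mA _.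
apply: measurable_entriesD mX _; apply: measurable_entriesN.
by apply: measurable_entriesZ; exact: measurable_entriesM mV mYh.
Qed.

Lemma measurable_lyapunov xs phi Q wb wc :
  measurable_fun setT (@lyapunov R n p xs phi Q wb wc : state_space -> R).
Proof.
have mid : measurable_fun setT (id : state_space -> state_space) by exact: measurable_id.
have m1 := measurableT_comp measurable_fst mid.
have mX := measurable_entries_borel
  (measurableT_comp measurable_fst (measurableT_comp measurable_fst m1)).
have mY := measurable_entries_borel
  (measurableT_comp measurable_snd (measurableT_comp measurable_fst m1)).
have mC := measurable_entries_borel (measurableT_comp measurable_snd m1).
have mw := measurable_entries_borel (measurableT_comp measurable_snd mid).
have mqf (M : 'M[R]_n) (F : state_space -> 'M[R]_(n, p)) : measurable_entries F ->
    measurable_fun setT (fun s => qf M (F s)).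
  move=> mF; apply: measurable_trace; apply: measurable_entriesM.
    exact: measurable_entries_cst.
  by apply: measurable_entriesM => //; exact: measurable_entries_tr.
have mc m q (M : 'M[R]_(m, q)) := @measurable_entries_cst R _ state_space _ _ M.
apply: measurable_funD.
  apply: measurable_nsq; apply: measurable_entriesD (mc _ _ _).
  exact: measurable_entriesM (mc _ _ _) mX.
apply: measurable_funD; first by apply: measurable_funM => //; exact: mqf.
apply: measurable_funD.
  apply: measurable_funM => //; apply: measurable_nsq.
  exact: measurable_entriesD mX (measurable_entriesN mC).
apply: mqf; apply: (measurable_entriesD mY _); apply: measurable_entriesN.
by apply: measurable_entriesM mw _; exact: measurable_entriesM (mc _ _ _) mY.
Qed.

End Measurability.

Unset Implicit Arguments.
Set Strict Implicit.
Set Printing Implicit Defensive.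

(** * Convergence of the algorithm *)

Theorem theorem1
    (R : realType) (dsp : measure_display) (T : measurableType dsp)
    (P : probability T R) (n p : nat)
    (f : 'I_n -> 'rV[R]_p -> R) (e : rel 'I_n)
    (V : nat -> T -> {set 'I_n}) (A B : nat -> T -> 'M[R]_n)
    (X1 : 'M[R]_(n, p)) (L mu kappa : R) (xstar : 'rV[R]_p)
    (f_convex : forall i, convex_function [set: 'rV[R]_p] (f i))
    (f_smooth : forall i, smooth L (f i))
    (mu_gt0 : 0 < mu)
    (f_strongly_convex : strongly_convex mu (average f))
    (xstar_min : minimizer (average f) xstar)
    (VAB_iid : iid P [set t | (1 <= t)%N] (fun t => draw (V t) (A t) (B t)))
    (AB_compatible : forall t, (1 <= t)%N ->
       {ae P, forall w, compatible e (A t w) /\ compatible e (B t w)})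
    (A_stochastic : forall t, (1 <= t)%N ->
       {ae P, forall w, row_stochastic (A t w)})
    (B_stochastic : forall t, (1 <= t)%N ->
       {ae P, forall w, column_stochastic (B t w)})
    (EA_primitive : primitive_mx (mean_mx P (A 1%N)))
    (EB_primitive : primitive_mx (mean_mx P (B 1%N)))
    (kappa_gt0 : 0 < kappa)
    (AB_diag : forall t, (1 <= t)%N ->
       {ae P, forall w, forall i, kappa <= A t w i i /\ kappa <= B t w i i})
    (V_active : forall i, (0 < P [set w | i \in V 1%N w])%E) :
  exists2 eta0 : R, 0 < eta0 &
    forall (eta : R) (i : 'I_n), 0 < eta -> eta <= eta0 ->
      {ae P, forall w,
         ppds_x f eta X1 (V ^~ w) (A ^~ w) (B ^~ w) i t @[t --> \oo] --> xstar}
      /\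
      exists c rho : R,
        [/\ 0 <= c, 0 < rho, rho < 1 &
            forall t : nat, (1 <= t)%N ->
              ('E_P[fun w =>
                  (enorm (ppds_x f eta X1 (V ^~ w) (A ^~ w) (B ^~ w) i t
                          - xstar) ^+ 2)%R]
                <= (c * rho ^+ t)%:E)%E].
Proof.
have [n0|n_gt0] := posnP n.
  by subst n; exists 1 => // eta [].
have mdraw t : (1 <= t)%N -> measurable_fun setT
    (fun w => draw (V t) (A t) (B t) w : node_subset n * borel_mx R n * borel_mx R n).
  by case: VAB_iid => + _ _; exact.
have md1 := mdraw 1%N isT.
have mVt := measurableT_comp measurable_fst (measurableT_comp measurable_fst md1).
have mAt := @measurable_entries_borel R _ _ n n _
  (measurableT_comp measurable_snd (measurableT_comp measurable_fst md1)).
have mBt := @measurable_entries_borel R _ _ n n _ (measurableT_comp measurable_snd md1).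
have mDt := @measurable_active_mx R n _ _ _ mVt.
have Ast := A_stochastic 1%N isT; have Bst := B_stochastic 1%N isT.
have Btst : {ae P, forall w, row_stochastic (B 1%N w)^T}.
  by move: Bst; apply: filterS => w; exact: column_stochastic_tr.
have hA : ess_bounded_mx P (A 1%N).
  move=> i j; split; first exact: mAt; exists 1.
  move: Ast; apply: filterS => w [A0 A1].
  by rewrite ger0_norm ?A0//; exact: entry_le1.
have hB : ess_bounded_mx P (B 1%N).
  move=> i j; split; first exact: mBt; exists 1.
  move: Btst; apply: filterS => w [B0 B1].
  have := entry_le1 B0 B1 j i; have := B0 j i; rewrite mxE => b0.
  by rewrite ger0_norm.
have hD : ess_bounded_mx P (fun w => active_mx R (V 1%N w)).
  move=> i j; split; first exact: mDt; exists 1; apply: aeW => w.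
  by have /andP[D0 D1] := @active_mx_entry R n (V 1%N w) i j; rewrite ger0_norm.
have Adiag : {ae P, forall w, forall i, kappa <= A 1%N w i i}.
  by have := AB_diag 1%N isT; apply: filterS => w h i; have [] := h i.
have Bdiag : {ae P, forall w, forall i, kappa <= B 1%N w i i}.
  by have := AB_diag 1%N isT; apply: filterS => w h i; have [] := h i.
have D_mean i : 0 < \int[P]_w active_mx R (V 1%N w) i i.
  have mVi : measurable [set w | i \in V 1%N w].
    have -> : [set w | i \in V 1%N w] = (V 1%N) @^-1` [set U : node_subset n | i \in (U : {set 'I_n})] by [].
    by rewrite -[X in measurable X]setTI; apply: mVt.
  rewrite /Rintegral (_ : (fun w => _) = (fun w => (\1_[set w | i \in V 1%N w] w)%:E)).
    rewrite integral_indic// setIT fine_gt0// V_active/=.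
    by rewrite (le_lt_trans (probability_le1 _ _))// ltry.
  apply/funext => w; rewrite !mxE eqxx mulr1n indicE.
  have -> // : (w \in [set w | i \in V 1%N w]) = (i \in V 1%N w).
  by apply/idP/idP; rewrite inE.
have [EA_ge0 EA1] := mean_row_stochastic hA Ast.
have EBt : mean_mx P (fun w => (B 1%N w)^T) = (mean_mx P (B 1%N))^T.
  by apply/matrixP => i j; rewrite !mxE; congr fine; congr expectation; apply/funext => w; rewrite mxE.
have EBt_prim : primitive_mx (mean_mx P (fun w => (B 1%N w)^T)).
  by rewrite EBt; exact: primitive_mx_tr.
have hBt := ess_bounded_mx_tr hB.
have [EB_ge0 EB1] := mean_row_stochastic hBt Btst.
have [k _ EAk] := EA_primitive.2; have [k' _ EBk] := EBt_prim.2.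
have [phi [phi_gt0 phi1 phiA]] := stationary_distribution EA_ge0 EA1 EAk n_gt0.
have [psi [psi_gt0 psi1 psiB]] := stationary_distribution EB_ge0 EB1 EBk n_gt0.
have [b0 b0_bnd A_contr] :=
  var_contraction hA Ast EA_primitive kappa_gt0 Adiag phi_gt0 phi1 phiA.
have [Q [e0 e0_bnd Q_contr]] :=
  gossip_lyapunov hB Btst EBt_prim kappa_gt0 Bdiag psi_gt0 psi1 psiB.
pose m : R := n%:R * (mu / 4).
have m_gt0 : 0 < m by rewrite mulr_gt0 ?ltr0n// divr_gt0.
have mono := strong_monotone f_smooth mu_gt0 f_strongly_convex xstar_min n_gt0.
have zero := sum_grad_minimizer f_smooth mu_gt0 f_strongly_convex xstar_min n_gt0.
have [wb [wc [eta0 [wb_gt0 wc_gt0 eta0_gt0 contr]]]] :=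
  mean_lyapunov (sqr_ge0 L) m_gt0 (gradF_lipschitz f_smooth) mono zero
    hA hD Ast Bst kappa_gt0 Adiag D_mean phi_gt0 phi1 phiA b0_bnd A_contr e0_bnd Q_contr.
have [K K_ge0 distK] := node_dist_lyapunov xstar phi_gt0 phi1 Q_contr wb_gt0 wc_gt0.
exists eta0 => // eta i eta_gt0 eta_le.
have [rho rho01 step_contr] := contr eta eta_gt0 eta_le.
have [rho_gt0 rho_lt1] := andP rho01.
pose lyap (s : state_space R n p) : R := lyapunov xstar phi Q wb wc s.
have lyap_ge0 s : 0 <= lyap s by exact: lyapunov_ge0.
have mlyap : measurable_fun setT lyap by exact: measurable_lyapunov.
pose stepf := @draw_step R n p (gradF f) eta.
have mstep : measurable_fun setT stepf.
  by apply: measurable_draw_step => d S F mF; exact: measurable_entries_gradF f_smooth mF.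
pose s0 : state_space R n p := ((X1, gradF f X1, X1), const_mx n%:R^-1).
pose zeta t w : draw_space R n := draw (V t) (A t) (B t) w.
(* Time [k.+1] of the algorithm is the state after [k] draws. *)
pose st := driven_state zeta stepf s0.
have stE k0 w : (st k0 w).1 = ppds_state f eta X1 (V ^~ w) (A ^~ w) (B ^~ w) k0.
  elim: k0 => [//|k0]; rewrite /st /=.
  by case: (driven_state zeta stepf s0 k0 w) => [[[X Y] C] u] /= <-.
have mst k0 : measurable_fun setT (st k0) by exact: (measurable_driven_state _ VAB_iid mstep).
have mX k0 := measurable_entries_borel (measurableT_comp measurable_fst
  (measurableT_comp measurable_fst (measurableT_comp measurable_fst (mst k0)))).
have bal0 : is_balanced (gradF f) s0.
  split => //=; first by move=> j; rewrite mxE invr_ge0.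
  apply/matrixP => a b; rewrite !mxE (eq_bigr (fun=> n%:R^-1)).
    by rewrite sumr_const card_ord -[LHS]mulr_natl divff// pnatr_eq0 -lt0n.
  by move=> j _; rewrite !mxE mul1r.
have bal k0 : {ae P, forall w, is_balanced (gradF f) (st k0 w)}.
  elim: k0 => [|k0 IH]; first exact: aeW.
  have := B_stochastic k0.+1 isT; move: IH; apply: filterS2 => w hs hB1.
  apply: is_balanced_step hB1 hs; exact: gradF_local.
have decay k0 : (\int[P]_w (lyap (st k0 w))%:E <= (lyap s0 * rho ^+ k0)%:E)%E.
  elim: k0 => [|k0 IH].
    rewrite (_ : (fun w => _) = cst (lyap s0)%:E)//.
    by rewrite integral_cst//= probability_setT mule1 expr0 mulr1.
  have mg : measurable_fun setT (fun x => (lyap (stepf x))%:E).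
    by apply/measurable_EFinP; exact: measurableT_comp.
  have g_ge0 x : (0 <= (lyap (stepf x))%:E)%E by rewrite lee_fin.
  rewrite (driven_state_fubini s0 VAB_iid mstep k0 mg g_ge0) -/st.
  apply: (@le_trans _ _ (\int[P]_w (rho * lyap (st k0 w))%:E)%E).
    apply: ae_ge0_le_integral => //.
    - by move=> w _; exact: integral_ge0.
    - exact: (measurable_mean_next s0 VAB_iid mstep k0 mg g_ge0).
    - by move=> w _; rewrite lee_fin mulr_ge0// ltW.
    - by apply/measurable_EFinP; apply: measurable_funM => //; exact: measurableT_comp.
    - move: (bal k0); apply: filterS => w hs _.
      have mw : measurable_fun setT (fun w' => lyap (stepf (st k0 w, zeta 1%N w'))).
        apply: (measurableT_comp (measurableT_comp mlyap mstep)).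
        exact: (measurable_fun_pair (measurable_cst _) md1).
      exact: mean_le_ge0_integral mw (fun w' => lyap_ge0 _) (step_contr _ hs).
  under eq_integral do rewrite EFinM.
  rewrite ge0_integralZl//; last 3 first.
  - by apply/measurable_EFinP; exact: measurableT_comp.
  - by move=> w _; rewrite lee_fin.
  - by rewrite lee_fin ltW.
  apply: le_trans (lee_wpmul2l _ IH) _; first by rewrite lee_fin ltW.
  by rewrite -EFinM lee_fin exprS mulrCA.
have xE t w : ppds_x f eta X1 (V ^~ w) (A ^~ w) (B ^~ w) i t = row i (st t.-1 w).1.1.1.
  by rewrite /ppds_x -stE.
have msts k0 : measurable_fun setT (fun w => lyap (st k0 w)) by exact: measurableT_comp.
split.
  have := geometric_means_cvg0 msts (fun k0 w => lyap_ge0 _) rho01 (lyap_ge0 s0) decay.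
  apply: filterS => w lyap0.
  rewrite -(cvg_shiftS _).
  under eq_fun do rewrite xE /=.
  apply: row_cvg; apply: (@squeeze_cvgr _ _ _ _ (fun=> 0) (fun k0 => K * lyap (st k0 w))).
  - by apply: nearW => k0; rewrite nsq_ge0 distK.
  - exact: cvg_cst.
  - by rewrite -(mulr0 K); apply: cvgM => //; exact: cvg_cst.
exists (K * lyap s0 / rho), rho; split => //.
  by rewrite divr_ge0 ?(ltW rho_gt0)// mulr_ge0.
move=> t t1; rewrite unlock.
apply: (@le_trans _ _ (\int[P]_w (K * lyap (st t.-1 w))%:E)%E).
  apply: ge0_le_integral => //.
  - by move=> w _; rewrite lee_fin sqr_ge0.
  - apply/measurable_EFinP; under eq_fun do rewrite enorm_sqr xE.
    apply: measurable_nsq; apply: measurable_entriesD; last exact: measurable_entries_cst.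
    by move=> a b; under eq_fun do rewrite mxE; exact: mX.
  - by apply/measurable_EFinP; apply: measurable_funM.
  - by move=> w _; rewrite lee_fin enorm_sqr xE distK.
under eq_integral do rewrite EFinM.
rewrite ge0_integralZl//; last 2 first.
- exact/measurable_EFinP.
- by move=> w _; rewrite lee_fin.
apply: le_trans (lee_wpmul2l _ (decay _)) _; first by rewrite lee_fin.
rewrite -EFinM lee_fin -{2}(prednK t1) exprS.
by rewrite le_eqVlt; apply/orP; left; apply/eqP; field; rewrite gt_eqF.
Qed.
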